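(* Let $G$ be a finite simple unmixed graph without $3$-cycles and without $5$-cycles. The following are equivalent: (a) $I_c(G)$ is linearly presented; (b) for all distinct minimal vertex covers $C_1,C_2$ of $G$, if the induced subgraph $G'=G[C_1\triangle C_2]$ is unmixed then $G'$ is Cohen–Macaulay.
   Context: $G$ has vertices $t_1,\dots,t_s$, $S=K[t_1,\dots,t_s]$, $K$ a field. A graph is unmixed if all minimal vertex covers (inclusion-minimal vertex sets meeting every edge) have equal size. $I_c(G)$ is generated by $\prod_{t_i\in C}t_i$ over minimal vertex covers $C$; a monomial ideal minimally generated by $u_1,\dots,u_r$ is linearly presented if all $u_i$ have the same degree and the kernel of $S^r\to S$, $e_i\mapsto u_i$, is generated by vectors with linear-form entries. $\triangle$ is symmetric difference, $G[L]$ the subgraph induced on $L$. A graph $H$ is Cohen–Macaulay if $R/I(H)$ is Cohen–Macaulay, with $R$ the polynomial ring on $V(H)$ and $I(H)$ generated by $tt'$ for edges $\{t,t'\}$ of $H$. *)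

(* Defs.v *)
From HB Require Import structures.
From mathcomp Require Import all_boot all_order all_algebra.
From mathcomp Require Import mpoly.
Set Implicit Arguments. Unset Strict Implicit. Unset Printing Implicit Defensive.
Import Order.TTheory GRing.Theory.
Local Open Scope ring_scope.

Definition simple_graph (s : nat) (e : rel 'I_s) : Prop :=
  ssrbool.symmetric e /\ ssrbool.irreflexive e.

Definition vertex_cover (s : nat) (e : rel 'I_s) (C : {set 'I_s}) : bool :=
  [forall x, forall y, e x y ==> (x \in C) || (y \in C)].

Definition min_vertex_cover (s : nat) (e : rel 'I_s) (C : {set 'I_s}) : bool :=
  minset (vertex_cover e) C.

Definition unmixed (s : nat) (e : rel 'I_s) : Prop :=
  forall C1 C2 : {set 'I_s}, min_vertex_cover e C1 -> min_vertex_cover e C2 ->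
    #|C1| = #|C2|.

Definition has_3cycle (s : nat) (e : rel 'I_s) : Prop :=
  exists a b c : 'I_s, [/\ uniq [:: a; b; c], e a b, e b c & e c a].

Definition has_5cycle (s : nat) (e : rel 'I_s) : Prop :=
  exists a b c d f : 'I_s,
    [/\ uniq [:: a; b; c; d; f], e a b, e b c, e c d & (e d f && e f a)].

Definition symdiff (T : finType) (A B : {set T}) : {set T} :=
  (A :\: B) :|: (B :\: A).

Definition induced (s : nat) (e : rel 'I_s) (L : {set 'I_s}) : rel 'I_#|L| :=
  fun i j => e (enum_val i) (enum_val j).
Arguments induced [s] e L _ _.

Definition gen_ideal (K : fieldType) (n : nat) (P : {mpoly K[n]} -> Prop)
  : {mpoly K[n]} -> Prop :=
  fun f => exists k (a g : 'I_k -> {mpoly K[n]}),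
    (forall j, P (g j)) /\ f = \sum_(j < k) a j * g j.

Definition max_ideal (K : fieldType) (n : nat) : {mpoly K[n]} -> Prop :=
  gen_ideal (fun g => exists i : 'I_n, g = 'X_i).

Definition edge_gens (K : fieldType) (n : nat) (e : rel 'I_n)
  : {mpoly K[n]} -> Prop :=
  fun g => exists i j : 'I_n, e i j /\ g = 'X_i * 'X_j.

Definition ideal_plus_seq (K : fieldType) (n : nat) (I : {mpoly K[n]} -> Prop)
  (f : seq {mpoly K[n]}) : {mpoly K[n]} -> Prop :=
  gen_ideal (fun g => I g \/ g \in f).

Definition regular_seq (K : fieldType) (n : nat) (I : {mpoly K[n]} -> Prop)
  (f : seq {mpoly K[n]}) : Prop :=
  [/\ (forall x, x \in f -> max_ideal x),
      (forall i, (i < size f)%N -> forall g : {mpoly K[n]},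
         ideal_plus_seq I (take i f) (f`_i * g) ->
         ideal_plus_seq I (take i f) g)
    & ~ ideal_plus_seq I f 1].

Definition depth_is (K : fieldType) (n : nat) (I : {mpoly K[n]} -> Prop)
  (d : nat) : Prop :=
  (exists f, size f = d /\ regular_seq I f) /\
  ~ (exists f, size f = d.+1 /\ regular_seq I f).

Definition is_prime_ideal (K : fieldType) (n : nat) (P : {mpoly K[n]} -> Prop)
  : Prop :=
  [/\ P 0, (forall x y, P x -> P y -> P (x + y)),
      (forall a x, P x -> P (a * x)), ~ P 1
    & (forall x y, P (x * y) -> P x \/ P y)].

(* a strictly increasing chain P_0 < P_1 < ... < P_d of primes containing I
   (i.e. a chain of primes of R/I of length d) *)
Definition prime_chain (K : fieldType) (n : nat) (I : {mpoly K[n]} -> Prop)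
  (d : nat) (P : nat -> {mpoly K[n]} -> Prop) : Prop :=
  (forall i, (i <= d)%N -> is_prime_ideal (P i) /\ (forall x, I x -> P i x)) /\
  (forall i, (i < d)%N -> (forall x, P i x -> P i.+1 x) /\
                          exists x, P i.+1 x /\ ~ P i x).

Definition krull_dim_is (K : fieldType) (n : nat) (I : {mpoly K[n]} -> Prop)
  (d : nat) : Prop :=
  (exists P, prime_chain I d P) /\ ~ (exists P, prime_chain I d.+1 P).

(* R/I Cohen-Macaulay (graded setting): depth R/I = dim R/I *)
Definition cohen_macaulay_quot (K : fieldType) (n : nat)
  (I : {mpoly K[n]} -> Prop) : Prop :=
  exists d, depth_is I d /\ krull_dim_is I d.

Definition CM_graph (K : fieldType) (n : nat) (e : rel 'I_n) : Prop :=
  cohen_macaulay_quot (gen_ideal (@edge_gens K n e)).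

Definition min_covers (s : nat) (e : rel 'I_s) : {set {set 'I_s}} :=
  [set C | min_vertex_cover e C].

(* u_i = prod_{t in C_i} t, C_i the i-th minimal vertex cover; these are the
   minimal monomial generators of I_c(G) *)
Definition cover_gen (K : fieldType) (s : nat) (e : rel 'I_s)
  (i : 'I_#|min_covers e|) : {mpoly K[s]} :=
  \prod_(t in enum_val i) 'X_t.

Definition syzygy (K : fieldType) (s r : nat) (u : 'I_r -> {mpoly K[s]})
  (v : 'I_r -> {mpoly K[s]}) : Prop :=
  \sum_(i < r) v i * u i = 0.

Definition linear_form (K : fieldType) (s : nat) (p : {mpoly K[s]}) : bool :=
  p \is 1.-homog.

(* the monomial ideal minimally generated by u_1..u_r is linearly presented:
   all u_i have the same degree and the kernel of S^r -> S, e_i |-> u_i,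
   is generated (as an S-module) by vectors with linear-form entries *)
Definition linearly_presented (K : fieldType) (s r : nat)
  (u : 'I_r -> {mpoly K[s]}) : Prop :=
  (exists d, forall i, u i \is d.-homog) /\
  forall v, syzygy u v ->
    exists k (a : 'I_k -> {mpoly K[s]}) (w : 'I_k -> 'I_r -> {mpoly K[s]}),
      (forall j, syzygy u (w j) /\ forall i, linear_form (w j i)) /\
      forall i, v i = \sum_(j < k) a j * w j i.

Definition cover_ideal_linearly_presented (K : fieldType) (s : nat)
  (e : rel 'I_s) : Prop :=
  linearly_presented (@cover_gen K s e).

(* Main.v *)
Require Import Defs.
From mathcomp Require Import all_boot all_order all_algebra.
From mathcomp Require Import mpoly.
Set Implicit Arguments. Unset Strict Implicit. Unset Printing Implicit Defensive.
Import GRing.Theory.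
Local Open Scope ring_scope.

(** Both conditions are equivalent to the following one ([no_complete_diff]): there
    are no minimal vertex covers [C1], [C2] with [|C1 \ C2| >= 2] such that every
    vertex of [C1 \ C2] is adjacent to every vertex of [C2 \ C1].

    If it holds, a nonadjacent pair [x], [y] in the two differences gives a minimal
    cover inside [(C1 u C2) \ {x, y}], closer to both [C1] and [C2]; by induction
    [C1] and [C2] are joined by swaps of single vertices inside [C1 u C2], which
    telescope the pairwise syzygies into linear ones.  Conversely, a linear
    presentation gives a cover obtained from [C1] by one swap [c -> t] with [t] in
    [C2 \ C1], and if the differences are completely joined this is either
    impossible or creates a triangle.

    When the graph [G'] induced on the symmetric difference is unmixed, the condition
    passes to it, and the swaps from one side to the other enumerate a perfect matching
    [x_i y_i] such that [x_i ~ y_j] is a partial order of which the enumeration is a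
    linear extension.  The forms [x_i + y_i] are then a regular sequence of the
    right length.  On the other hand, completely joined differences give an unmixed
    complete bipartite [G'], of depth 1 and dimension at least 2.

    Dimension and depth are bounded without any dimension theory: monomials in a
    regular sequence, or in elements separating a chain of primes, are linearly
    independent modulo the edge ideal [I], while the number of monomials of degree
    at most [b] outside [I] is [O(b^d)], [d] the maximal size of a stable set. *)

(** * Ideals and regular sequences *)

Definition is_ideal (R : comNzRingType) (J : R -> Prop) : Prop :=
  [/\ J 0, forall f g, J f -> J g -> J (f + g) & forall a f, J f -> J (a * f)].

Definition ideal_add (R : comNzRingType) (J : R -> Prop) (f : R) : R -> Prop :=
  fun g => exists a, J (g - a * f).

Definition nonzerodiv (R : comNzRingType) (J : R -> Prop) (f : R) : Prop :=
  forall g, J (f * g) -> J g.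

(** Properness of the last ideal is left aside, so that gluing along exact sequences never has to
    check it; [weakly_regular_regular_seq] supplies it through constant terms. *)
Fixpoint weakly_regular (R : comNzRingType) (J : R -> Prop) (fs : seq R) : Prop :=
  if fs is f :: fs' then nonzerodiv J f /\ weakly_regular (ideal_add J f) fs'
  else True.

Lemma idealN (R : comNzRingType) (J : R -> Prop) f : is_ideal J -> J f -> J (- f).
Proof. by move=> [_ _ JM] Jf; rewrite -mulN1r; apply: JM. Qed.

Lemma idealB (R : comNzRingType) (J : R -> Prop) f g :
  is_ideal J -> J f -> J g -> J (f - g).
Proof. by move=> iJ Jf Jg; case: (iJ) => _ JD _; apply: JD => //; apply: idealN. Qed.

Lemma ideal_sum (R : comNzRingType) (J : R -> Prop) (T : eqType) (r : seq T)
    (F : T -> R) :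
  is_ideal J -> {in r, forall i, J (F i)} -> J (\sum_(i <- r) F i).
Proof.
case=> J0 JD _ JF; rewrite big_seq.
by elim/big_ind: _ => // i /JF.
Qed.

Lemma ideal_add_ideal (R : comNzRingType) (J : R -> Prop) f :
  is_ideal J -> is_ideal (ideal_add J f).
Proof.
move=> [J0 JD JM]; split.
- by exists 0; rewrite mul0r subrr.
- move=> g h [a Ja] [b Jb]; exists (a + b).
  by rewrite mulrDl opprD addrACA; apply: JD.
- move=> a g [b Jb]; exists (a * b).
  by rewrite -mulrA -mulrBr; apply: JM.
Qed.

Lemma ideal_add_sub (R : comNzRingType) (J : R -> Prop) f g :
  J g -> ideal_add J f g.
Proof. by exists 0; rewrite mul0r subr0. Qed.

Lemma ideal_add_gen (R : comNzRingType) (J : R -> Prop) f :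
  is_ideal J -> ideal_add J f f.
Proof. by case=> J0 _ _; exists 1; rewrite mul1r subrr. Qed.

Lemma weakly_regular_ext (R : comNzRingType) (fs : seq R) (J J' : R -> Prop) :
  (forall g, J g <-> J' g) -> weakly_regular J fs -> weakly_regular J' fs.
Proof.
elim: fs J J' => //= f fs IH J J' JJ' [nz reg]; split.
  by move=> g /JJ'/nz/JJ'.
by apply: IH reg => g; split=> -[a /JJ' Ja]; exists a.
Qed.

(* The exact sequence 0 -> R/(J : u) -> R/J -> R/(J, u) -> 0 stays exact modulo
   each member of a sequence which is regular on both ends. *)
Lemma weakly_regular_glue (R : comNzRingType) (fs : seq R) (J J1 J2 : R -> Prop) u :
  is_ideal J -> (forall g, J1 g <-> J (u * g)) ->
  (forall g, J2 g <-> ideal_add J u g) ->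
  weakly_regular J1 fs -> weakly_regular J2 fs -> weakly_regular J fs.
Proof.
elim: fs J J1 J2 => //= f fs IH J J1 J2 iJ eJ1 eJ2 [nz1 reg1] [nz2 reg2].
have [J0 JD JM] := iJ.
split=> [g Jfg|].
  have /eJ2[a Ja] : J2 g by apply/nz2/eJ2/ideal_add_sub.
  have /nz1/eJ1 : J1 (f * a).
    apply/eJ1; have -> : u * (f * a) = f * g - f * (g - a * u).
      by rewrite mulrBr opprB addrC subrK mulrCA [u * a]mulrC.
    by apply: idealB => //; apply: JM.
  by move=> Jua; rewrite -(subrK (a * u) g); apply: JD => //; rewrite mulrC.
apply: IH reg1 reg2; first exact: ideal_add_ideal.
  move=> h; split=> [[a /eJ1]|[g Jg]].
    by rewrite mulrBr [u * (a * f)]mulrA => ?; exists (u * a).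
  have /nz2/eJ2[k Jk] : J2 (f * g).
    apply/eJ2; exists h; have -> : f * g - h * u = - (u * h - g * f).
      by rewrite opprB [f * g]mulrC [h * u]mulrC.
    exact: idealN.
  exists k; apply/eJ1; have -> : u * (h - k * f) = (u * h - g * f) + f * (g - k * u).
    rewrite !mulrBr [f * g]mulrC addrA subrK; congr (_ - _).
    by rewrite mulrCA [f * _]mulrC -mulrA [u * f]mulrC mulrA.
  by apply: JD => //; apply: JM.
move=> g; split=> [[a /eJ2[b Jb]]|[b [a Ja]]].
  by exists b, a; rewrite addrAC.
by exists a; apply/eJ2; exists b; rewrite addrAC.
Qed.

(** * Stanley-Reisner ideals *)

Definition mnm_supp (n : nat) (m : 'X_{1..n}) : {set 'I_n} :=
  [set i | m i != 0%N].

Definition down_closed (T : finType) (D : pred {set T}) : Prop :=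
  forall A B : {set T}, A \subset B -> D B -> D A.

(** The Stanley-Reisner ideal of the complex [D], encoded by vanishing coefficients instead of
    generators, so that membership is tested monomial by monomial. *)
Definition face_ideal (K : fieldType) (n : nat) (D : pred {set 'I_n})
  : {mpoly K[n]} -> Prop :=
  fun f => forall m, D (mnm_supp m) -> f@_m = 0.

Lemma mnm_suppD n (m1 m2 : 'X_{1..n}) :
  mnm_supp (m1 + m2)%MM = mnm_supp m1 :|: mnm_supp m2.
Proof. by apply/setP=> i; rewrite !inE mnmDE addn_eq0 negb_and. Qed.

Lemma mnm_suppU n (i : 'I_n) : mnm_supp U_(i)%MM = [set i].
Proof. by apply/setP=> j; rewrite !inE mnm1E [j == i]eq_sym; case: (i == j). Qed.

Lemma mnm_supp0 n : mnm_supp (0%MM : 'X_{1..n}) = set0.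
Proof. by apply/setP=> j; rewrite !inE mnm0E. Qed.

Lemma face_ideal_ideal (K : fieldType) n (D : pred {set 'I_n}) :
  down_closed D -> is_ideal (@face_ideal K n D).
Proof.
move=> dD; split=> [m _|f g If Ig m Dm|a f If m Dm].
- by rewrite mcoeff0.
- by rewrite mcoeffD If // Ig // addr0.
- apply/eqP; rewrite mcoeff_eq0; apply/negP=> /msuppM_le/allpairsP[[m1 m2] /=].
  case=> _ + em; rewrite mcoeff_msupp If ?eqxx //.
  by apply: dD Dm; rewrite em mnm_suppD subsetUr.
Qed.

Lemma face_ideal_sub (K : fieldType) n (D D' : pred {set 'I_n}) f :
  (forall S, D' S -> D S) -> @face_ideal K n D f -> face_ideal D' f.
Proof. by move=> DD' If m /DD'/If. Qed.

Lemma face_ideal_ext (K : fieldType) n (D D' : pred {set 'I_n}) f :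
  D =1 D' -> @face_ideal K n D f <-> face_ideal D' f.
Proof. by move=> DD'; split; apply: face_ideal_sub => S; rewrite DD'. Qed.

Lemma face_idealX (K : fieldType) n (D : pred {set 'I_n}) m :
  face_ideal D ('X_[m] : {mpoly K[n]}) <-> ~~ D (mnm_supp m).
Proof.
split=> [Im|Dm k Dk].
  by apply/negP=> /Im/eqP; rewrite mcoeffX eqxx oner_eq0.
by rewrite mcoeffX; case: eqP => // ek; rewrite ek Dk in Dm.
Qed.

(** Multiplying by ['X_v] adds [v] to every support, so the colon ideal by ['X_v] belongs to the
    star of [v]. *)
Lemma face_ideal_colon (K : fieldType) n (D : pred {set 'I_n}) v g :
  @face_ideal K n (fun S => D (v |: S)) g <-> face_ideal D ('X_v * g).
Proof.
split=> [Ig m Dm|Ig m Dm]; last first.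
  rewrite -(mcoeffMX g U_(v)) mulrC Ig // mnm_suppD mnm_suppU; exact: Dm.
apply/eqP; rewrite mcoeff_eq0 mulrC (perm_mem (msuppMX _ _)).
apply/negP=> /mapP[k kg em]; move: kg; rewrite mcoeff_msupp Ig ?eqxx //.
by rewrite -mnm_suppU -mnm_suppD -em.
Qed.

Lemma mpoly_shift (K : fieldType) n (g : {mpoly K[n]}) v :
  exists a : {mpoly K[n]}, forall k, a@_k = g@_(U_(v) + k).
Proof.
elim/mpolyind: g => [|c m g _ _ [a Ea]]; first by exists 0 => k; rewrite !mcoeff0.
case: (boolP (U_(v) <= m)%MM) => [le|nle].
  exists (c *: 'X_[(m - U_(v))%MM] + a) => k.
  rewrite !mcoeffD Ea !mcoeffZ !mcoeffX -(eqm_add2l U_(v)%MM) addmC.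
  by rewrite (submK le).
exists a => k; rewrite mcoeffD Ea mcoeffZ mcoeffX.
case: eqP => [em|]; last by rewrite mulr0 add0r.
by move: nle; rewrite em lem_addr.
Qed.

(** The multiplier is the quotient of [g] by ['X_v], terms free of ['X_v] being discarded;
    subtracting its product with ['X_v] removes exactly the terms whose support contains [v]. *)
Lemma face_ideal_del (K : fieldType) n (D : pred {set 'I_n}) v g :
  down_closed D ->
  @face_ideal K n (fun S => D S && (v \notin S)) g <->
  ideal_add (face_ideal D) 'X_v g.
Proof.
move=> dD; split=> [Ig|[a Ia] m /andP[Dm vm]].
  have [a Ea] := mpoly_shift g v; exists a => m Dm; rewrite mcoeffB.
  case: (boolP (v \in mnm_supp m)) => vm.
    have le : (U_(v) <= m)%MM by rewrite lep1mP; rewrite inE in vm.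
    by rewrite -(submK le) [(_ + U_(v))%MM]addmC mcoeffMX Ea subrr.
  rewrite Ig ?Dm // sub0r; apply/eqP; rewrite oppr_eq0 mcoeff_eq0.
  rewrite (perm_mem (msuppMX _ _)); apply/negP=> /mapP[k _ em].
  by move: vm; rewrite em mnm_suppD mnm_suppU in_setU set11.
rewrite -[g](subrK (a * 'X_v)) mcoeffD Ia // add0r; apply/eqP.
rewrite mcoeff_eq0 (perm_mem (msuppMX _ _)); apply/negP=> /mapP[k _ em].
by move: vm; rewrite em mnm_suppD mnm_suppU in_setU set11.
Qed.

Lemma down_closed_simplex (T : finType) (F : {set T}) :
  down_closed (fun S : {set T} => S \subset F).
Proof. by move=> A B; apply: subset_trans. Qed.

(* Vertex by vertex reduction: star and deletion correspond to the two ends of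
   the exact sequence used in [weakly_regular_glue]. *)
Lemma weakly_regular_vertex (K : fieldType) n (D : pred {set 'I_n}) v fs :
  down_closed D ->
  weakly_regular (@face_ideal K n (fun S => D (v |: S))) fs ->
  weakly_regular (@face_ideal K n (fun S => D S && (v \notin S))) fs ->
  weakly_regular (@face_ideal K n D) fs.
Proof.
move=> dD; apply: (weakly_regular_glue (u := 'X_v)); first exact: face_ideal_ideal.
  by move=> g; apply: face_ideal_colon.
by move=> g; apply: face_ideal_del.
Qed.

(** The prime generated by the variables outside [F], seen as the face ideal of the simplex on
    [F]. *)
Definition var_ideal (K : fieldType) (n : nat) (F : {set 'I_n})
  : {mpoly K[n]} -> Prop := face_ideal (fun S => S \subset F).
Arguments var_ideal : clear implicits.

Lemma var_ideal_ideal (K : fieldType) n F : is_ideal (var_ideal K n F).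
Proof. exact/face_ideal_ideal/down_closed_simplex. Qed.

Lemma var_idealX (K : fieldType) n F v : var_ideal K n F 'X_v <-> v \notin F.
Proof. by rewrite /var_ideal face_idealX mnm_suppU sub1set. Qed.

(* Modulo the variables outside [F], [a + b] acts as the single variable [a]. *)
Lemma var_ideal_pair (K : fieldType) n (F : {set 'I_n}) a b :
  a \in F -> b \notin F ->
  nonzerodiv (var_ideal K n F) ('X_a + 'X_b) /\
  forall g, ideal_add (var_ideal K n F) ('X_a + 'X_b) g <->
            var_ideal K n (F :\ a) g.
Proof.
move=> aF bF; have iF := var_ideal_ideal K F; have [F0 FD FM] := iF.
have Fb c : var_ideal K n F (c * 'X_b) by apply/FM/var_idealX.
split=> [g Fg|g].
  have : var_ideal K n F ('X_a * g).
    have -> : 'X_a * g = ('X_a + 'X_b) * g - g * 'X_b.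
      by rewrite mulrDl [g * _]mulrC addrK.
    exact: (idealB iF).
  rewrite /var_ideal -face_ideal_colon; apply: face_ideal_sub => S SF.
  by rewrite subUset sub1set aF.
apply: (@iff_trans _ (ideal_add (var_ideal K n F) 'X_a g)).
  split=> -[c Fc]; exists c.
    have -> : g - c * 'X_a = g - c * ('X_a + 'X_b) + c * 'X_b.
      by rewrite mulrDr opprD addrA subrK.
    exact: FD.
  by rewrite mulrDr opprD addrA; apply: (idealB iF).
rewrite -face_ideal_del; last exact: down_closed_simplex.
by apply: face_ideal_ext => S; rewrite subsetD1.
Qed.

(** [F] contains exactly one end of each pair, so every form acts as a single variable. Passing to
    the quotient deletes that end from [F] and leaves the other pairs untouched. *)
Lemma weakly_regular_var_ideal (K : fieldType) n (T : eqType) (x y : T -> 'I_n)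
    (s : seq T) (F : {set 'I_n}) :
  injective x -> injective y -> (forall i j, x i != y j) -> uniq s ->
  {in s, forall i, (x i \in F) = (y i \notin F)} ->
  weakly_regular (var_ideal K n F) [seq 'X_(x i) + 'X_(y i) | i <- s].
Proof.
move=> xI yI xy; elim: s F => //= i s IH F /andP[si us] Fs.
have Fi : (x i \in F) = (y i \notin F) by apply: Fs; rewrite mem_head.
have Fs' : {in s, forall j, (x j \in F) = (y j \notin F)}.
  by move=> j js; apply: Fs; rewrite inE js orbT.
have ne j : j \in s -> i != j by apply: contraTneq => <-.
have [xF|xF] := boolP (x i \in F).
  have yF : y i \notin F by rewrite -Fi.
  have [nz E] := var_ideal_pair K xF yF; split=> //.
  apply: (@weakly_regular_ext _ _ (var_ideal K n (F :\ x i))).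
    by move=> g; split=> /E.
  apply: IH => // j js; rewrite !inE Fs' // (eq_sym (y j)) xy.
  by rewrite (inj_eq xI) eq_sym (negPf (ne j js)).
have yF : y i \in F by apply: contraNT xF; rewrite -Fi.
rewrite [_ + _]addrC.
have [nz E] := var_ideal_pair K yF xF; split=> //.
apply: (@weakly_regular_ext _ _ (var_ideal K n (F :\ y i))).
  by move=> g; split=> /E.
apply: IH => // j js; rewrite !inE Fs' // xy.
by rewrite (inj_eq yI) eq_sym (negPf (ne j js)).
Qed.

(** The retraction onto the polynomial ring on [F]. Its kernel is [var_ideal], which gives primality
    and canonical representatives. *)
Definition kill (K : fieldType) (n : nat) (F : {set 'I_n}) (p : {mpoly K[n]})
  : {mpoly K[n]} :=
  p \mPo [tuple (if i \in F then 'X_i else 0) | i < n].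

Lemma killX (K : fieldType) n (F : {set 'I_n}) m :
  kill F ('X_[m] : {mpoly K[n]}) = if mnm_supp m \subset F then 'X_[m] else 0.
Proof.
rewrite /kill comp_mpolyX; case: ifP => [/subsetP mF|/negbT/subsetPn[i im iF]].
  rewrite mpolyXE_id; apply: eq_bigr => i _; rewrite tnth_mktuple.
  case: ifPn => // iF; have : i \notin mnm_supp m by apply: contra iF; apply: mF.
  by rewrite inE negbK => /eqP->; rewrite !expr0.
rewrite (bigD1 i) //= tnth_mktuple (negPf iF); move: im; rewrite inE => im.
by rewrite expr0n (negPf im) mul0r.
Qed.

Lemma mcoeff_kill (K : fieldType) n (F : {set 'I_n}) (p : {mpoly K[n]}) m :
  (kill F p)@_m = if mnm_supp m \subset F then p@_m else 0.
Proof.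
elim/mpolyind: p => [|c k p _ _ IH].
  by rewrite /kill comp_mpoly0 mcoeff0 if_same.
have -> : kill F (c *: 'X_[k] + p) = c *: kill F 'X_[k] + kill F p.
  by rewrite /kill comp_mpolyD comp_mpolyZ.
rewrite mcoeffD IH mcoeffZ killX mcoeffD mcoeffZ.
case: (boolP (mnm_supp k \subset F)) => kF.
  by rewrite mcoeffX; case: eqP => [<-|]; rewrite ?kF ?mulr0 ?add0r.
rewrite mcoeff0 mulr0 add0r mcoeffX; case: eqP => [ek|]; last by rewrite mulr0 add0r.
by rewrite -ek (negPf kF).
Qed.

Lemma var_ideal_kill (K : fieldType) n (F : {set 'I_n}) f :
  var_ideal K n F f <-> kill F f = 0.
Proof.
split=> [Ff|kf m mF].
  by apply/mpolyP=> m; rewrite mcoeff_kill mcoeff0; case: ifP => // /Ff.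
by move: (mcoeff_kill F f m); rewrite kf mcoeff0 mF.
Qed.

Lemma killM (K : fieldType) n (F : {set 'I_n}) : {morph @kill K n F : p q / p * q}.
Proof. by move=> p q; rewrite /kill rmorphM. Qed.

Lemma kill_id (K : fieldType) n (F : {set 'I_n}) (p : {mpoly K[n]}) :
  var_ideal K n F (p - kill F p).
Proof. by move=> m mF; rewrite mcoeffB mcoeff_kill mF subrr. Qed.

Lemma var_ideal_prime (K : fieldType) n (F : {set 'I_n}) :
  is_prime_ideal (var_ideal K n F).
Proof.
have [F0 FD FM] := var_ideal_ideal K F; split=> // [F1|x y].
  have := F1 0%MM; rewrite mnm_supp0 sub0set mcoeff1 eqxx => /(_ isT)/eqP.
  by rewrite oner_eq0.
rewrite !var_ideal_kill killM => /eqP; rewrite mulf_eq0.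
by case/orP=> /eqP; [left|right].
Qed.

(** * Bounding dimension and depth by counting monomials *)

(* Common generalisation of a regular sequence modulo [J] and of the elements
   [f_i] in [P_i] but not in [P_(i-1)] along a chain of primes above [J]. *)
Fixpoint param_chain (R : comNzRingType) (J : R -> Prop) (fs : seq R) : Prop :=
  if fs is f :: fs' then
    nonzerodiv J f /\
    exists J', [/\ is_ideal J', forall g, J g -> J' g, J' f & param_chain J' fs']
  else ~ J 1.

Definition lin_indep (K : fieldType) n (J : {mpoly K[n]} -> Prop)
  (s : seq {mpoly K[n]}) : Prop :=
  forall c : nat -> K, J (\sum_(i < size s) c i *: s`_i) ->
  forall i, (i < size s)%N -> c i = 0.

(** All products of powers of the [fs] with exponents below [N]. The iteration is a Horner scheme in
    [f]: each round multiplies the earlier products by [f] and puts those free of [f] in front. *)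
Fixpoint box_monomials (R : nzRingType) (N : nat) (fs : seq R) : seq R :=
  if fs is f :: fs' then
    iter N (fun t => box_monomials N fs' ++ [seq f * g | g <- t]) [::]
  else [:: 1].

Lemma size_box_monomials (R : nzRingType) N (fs : seq R) :
  size (box_monomials N fs) = (N ^ size fs)%N.
Proof.
elim: fs => //= f fs IH; rewrite expnS -{}IH; move: (box_monomials N fs) => s.
by elim: N => //= N IH; rewrite size_cat size_map IH mulSn.
Qed.

(** Multiples of [f] vanish modulo [J'], which kills the coefficients on [s]. Cancelling [f] modulo
    [J] then leaves a relation on [t]. *)
Lemma lin_indep_cat (K : fieldType) n (J J' : {mpoly K[n]} -> Prop) f s t :
  is_ideal J' -> (forall g, J g -> J' g) -> J' f -> nonzerodiv J f ->
  lin_indep J' s -> lin_indep J t -> lin_indep J (s ++ [seq f * g | g <- t]).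
Proof.
move=> iJ' JJ' J'f nz indS indT c.
rewrite size_cat size_map big_split_ord /=.
under eq_bigr => i _ do rewrite nth_cat ltn_ord.
under [X in _ + X]eq_bigr => i _.
  rewrite nth_cat ltnNge leq_addr /= addKn (nth_map 0) // scalerAr; over.
rewrite -mulr_sumr => Jc.
set B := \sum_(i < size t) _ in Jc.
have c1 i : (i < size s)%N -> c i = 0.
  apply: indS; set A := (X in J' X).
  have [_ _ J'M] := iJ'; have -> : A = (A + f * B) - B * f by rewrite [B * f]mulrC addrK.
  by apply: idealB => //; [apply: JJ'|apply: J'M].
have c2 i : (i < size t)%N -> c (size s + i)%N = 0.
  apply: (indT (fun i => c (size s + i)%N)); apply: nz.
  by move: Jc; rewrite big1 ?add0r // => j _; rewrite c1 ?scale0r.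
move=> i lt_i; case: (ltnP i (size s)) => [/c1 //|le].
by rewrite -(subnKC le) c2 // ltn_subLR.
Qed.

Lemma lin_indep_box (K : fieldType) n N (fs : seq {mpoly K[n]})
    (J : {mpoly K[n]} -> Prop) :
  is_ideal J -> param_chain J fs -> lin_indep J (box_monomials N fs).
Proof.
elim: fs J => [|f fs IH] J iJ /=.
  move=> J1 c /=; rewrite big_ord1 /= => Jc [|//] _.
  apply/eqP/negPn/negP=> c0; apply: J1; have [_ _ JM] := iJ.
  have -> : 1 = (c 0%N)^-1%:MP * (c 0%N *: 1) :> {mpoly K[n]}.
    by rewrite mul_mpolyC scalerA mulVf // scale1r.
  exact: JM.
move=> [nz [J' [iJ' JJ' J'f pc]]]; have := IH J' iJ' pc.
move: (box_monomials N fs) => s indS {IH}.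
elim: N => [c _ i|N IHN] //; exact: (lin_indep_cat iJ').
Qed.

Lemma mdeg_box (K : fieldType) n N (fs : seq {mpoly K[n]}) g m :
  g \in box_monomials N fs -> m \in msupp g ->
  (mdeg m <= N * \sum_(f <- fs) msize f)%N.
Proof.
elim: fs g m => [|f fs IH] g m /=.
  by rewrite inE => /eqP->; rewrite msupp1 inE => /eqP->; rewrite mdeg0.
rewrite big_cons mulnDr; move: (box_monomials N fs) IH => s IH.
have : forall k, g \in iter k (fun t => s ++ [seq f * h | h <- t]) [::] ->
    m \in msupp g -> (mdeg m <= k * msize f + N * \sum_(f0 <- fs) msize f0)%N.
  move=> k; elim: k g m => //= k IHk g m.
  rewrite mem_cat => /orP[gs mg|/mapP[h hk ->] /msuppM_le/allpairsP[[m1 m2] /=]].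
    exact: leq_trans (IH _ _ gs mg) (leq_addl _ _).
  case=> /msize_mdeg_lt m1f m2h ->; rewrite mdegD mulSn -addnA.
  by apply: leq_add; [apply: ltnW|apply: IHk hk m2h].
exact.
Qed.

(** A monomial is determined by its support and by its exponents listed along the support, a list of
    length at most [d] padded with zeros. *)
Lemma card_mnm_faces n (D : pred {set 'I_n}) d b :
  (forall S, D S -> (#|S| <= d)%N) ->
  (#|[set m : 'X_{1..n < b.+1} | D (mnm_supp m)]| <= 2 ^ n * b.+1 ^ d)%N.
Proof.
move=> Dd.
pose enc (m : 'X_{1..n < b.+1}) : {set 'I_n} * {ffun 'I_d -> 'I_b.+1} :=
  (mnm_supp m, [ffun i : 'I_d =>
     inord (nth 0%N [seq (m : 'X_{1..n}) v | v <- enum (mnm_supp m)] i)]).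
have -> : (2 ^ n * b.+1 ^ d)%N = #|{: {set 'I_n} * {ffun 'I_d -> 'I_b.+1}}|.
  rewrite card_prod card_ffun !card_ord -[#|_ : predArgType|]cardsT -powersetT.
  by rewrite card_powerset cardsT card_ord.
rewrite cardE -(size_map enc) cardE; apply: uniq_leq_size; last first.
  by move=> p _; rewrite mem_enum.
rewrite map_inj_in_uniq ?enum_uniq // => m1 m2.
rewrite !mem_enum !inE => D1 D2 [eS eF].
apply/val_inj/mnmP=> v; have [vS|] := boolP (v \in mnm_supp m1); last first.
  move=> vS; have vS2 := vS; rewrite eS in vS2.
  by move: vS vS2; rewrite !inE !negbK => /eqP-> /eqP->.
have lt_i : (index v (enum (mnm_supp m1)) < d)%N.
  apply: leq_trans (Dd _ D1); rewrite cardE index_mem mem_enum //.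
have mb (m : 'X_{1..n < b.+1}) : (m v < b.+1)%N.
  rewrite ltnS; apply: leq_trans (_ : _ <= mdeg m)%N _; last by have := bmdeg m.
  by rewrite mdegE (bigD1 v) //= leq_addr.
have nthE (m : 'X_{1..n < b.+1}) : mnm_supp m = mnm_supp m1 ->
  nth 0%N [seq (m : 'X_{1..n}) w | w <- enum (mnm_supp m)]
    (index v (enum (mnm_supp m1))) = m v.
  by move=> ->; rewrite (nth_map v) ?nth_index ?index_mem ?mem_enum.
have := congr1 (fun f : {ffun 'I_d -> 'I_b.+1} => val (f (Ordinal lt_i))) eF.
rewrite !ffunE /= !nthE // !inordK //.
Qed.

(** A longer chain would yield at least [N ^ d.+1] polynomials of degree at most [N * B],
    independent modulo [J], hence modulo the face ideal; there are too few face monomials of that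
    degree to tell them apart. *)
Lemma size_param_chain (K : fieldType) n (D : pred {set 'I_n}) d
    (J : {mpoly K[n]} -> Prop) fs :
  (forall S, D S -> (#|S| <= d)%N) -> is_ideal J ->
  (forall g, face_ideal D g -> J g) -> param_chain J fs -> (size fs <= d)%N.
Proof.
move=> Dd iJ DJ pc; rewrite leqNgt; apply/negP=> lt_d.
pose B := (\sum_(f <- fs) msize f)%N.
(* Chosen so that [N ^ d.+1] exceeds [2 ^ n * (N * B.+1) ^ d], which dominates the number of face
   monomials of degree at most [N * B]. *)
pose N := (2 ^ n * B.+1 ^ d).+1.
pose s := box_monomials N fs.
pose M := [set m : 'X_{1..n < (N * B).+1} | D (mnm_supp m)].
(* Coefficients at face monomials: a relation between the rows is a combination of [s] lying in the
   face ideal. *)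
pose A := \matrix_(i < size s, j < #|M|) (s`_i)@_(enum_val j).
have indA : row_free A.
  apply: inj_row_free => v vA; apply/rowP=> i; rewrite mxE.
  have := @lin_indep_box K n N fs J iJ pc
            (fun k => if insub k is Some k' then v 0 k' else 0).
  rewrite -/s => /(_ _ i (ltn_ord i)); rewrite valK; apply; apply: DJ => m Dm.
  have [lt|ge] := ltnP (mdeg m) (N * B).+1.
    have mM : BMultinom lt \in M by rewrite inE.
    have := congr1 (fun X : 'rV__ => X 0 (enum_rank_in mM (BMultinom lt))) vA.
    rewrite !mxE raddf_sum /= => E; rewrite -[RHS]E.
    by apply: eq_bigr => k _; rewrite mcoeffZ valK mxE enum_rankK_in.
  rewrite raddf_sum big1 // => k _; rewrite /= mcoeffZ memN_msupp_eq0 ?mulr0 //.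
  apply: contraTN ge => mk; rewrite -ltnNge ltnS.
  by apply: mdeg_box mk; rewrite mem_nth.
have : (size s <= #|M|)%N by rewrite -(eqP indA) rank_leq_col.
rewrite leqNgt => /negP; apply.
apply: leq_ltn_trans (card_mnm_faces _ Dd) _.
rewrite size_box_monomials -/B.
apply: leq_trans (_ : N ^ d.+1 <= _)%N; last by rewrite leq_exp2l // ltnS muln_gt0 !expn_gt0.
apply: leq_ltn_trans (_ : 2 ^ n * (N * B.+1) ^ d < _)%N.
  rewrite leq_mul2l; apply/orP; right; case: (d) => // k; rewrite leq_exp2r //.
  by rewrite mulnS -addn1 addnC leq_add2r.
rewrite expnMn mulnCA expnS mulnC ltn_mul2r expn_gt0 /=.
by rewrite ltnS.
Qed.

(** * Edge ideals and the Cohen-Macaulay property *)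

Lemma gen_ideal_gen (K : fieldType) n (P : {mpoly K[n]} -> Prop) g :
  P g -> gen_ideal P g.
Proof.
move=> Pg; exists 1%N, (fun _ => 1), (fun _ => g); split=> //.
by rewrite big_ord1 mul1r.
Qed.

Lemma gen_ideal_ideal (K : fieldType) n (P : {mpoly K[n]} -> Prop) :
  is_ideal (gen_ideal P).
Proof.
split.
- by exists 0%N, (fun _ => 0), (fun _ => 0); split=> [[]|] //; rewrite big_ord0.
- move=> _ _ [k [a [g [Pg ->]]]] [l [b [h [Ph ->]]]].
  exists (k + l)%N, (fun j => match split j with inl i => a i | inr i => b i end),
    (fun j => match split j with inl i => g i | inr i => h i end).
  split=> [j|]; first by case: (split j).
  rewrite big_split_ord /=; congr (_ + _); apply: eq_bigr => i _.
    by rewrite -/(unsplit (inl i)) unsplitK.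
  by rewrite -/(unsplit (inr i)) unsplitK.
- move=> c _ [k [a [g [Pg ->]]]]; exists k, (fun j => c * a j), g; split=> //.
  by rewrite mulr_sumr; apply: eq_bigr => i _; rewrite mulrA.
Qed.

Lemma gen_ideal_min (K : fieldType) n (P J : {mpoly K[n]} -> Prop) f :
  is_ideal J -> (forall g, P g -> J g) -> gen_ideal P f -> J f.
Proof.
move=> iJ PJ [k [a [g [Pg ->]]]]; apply: ideal_sum => // j _.
by have [_ _ JM] := iJ; apply/JM/PJ.
Qed.

Lemma foldl_ideal_add_ideal (R : comNzRingType) (J : R -> Prop) fs :
  is_ideal J -> is_ideal (foldl (@ideal_add R) J fs).
Proof. by elim: fs J => //= f fs IH J iJ; apply/IH/ideal_add_ideal. Qed.

Lemma foldl_ideal_add_sub (R : comNzRingType) (J : R -> Prop) fs g :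
  J g -> foldl (@ideal_add R) J fs g.
Proof. by elim: fs J => //= f fs IH J Jg; apply/IH/ideal_add_sub. Qed.

Lemma foldl_ideal_add_gen (R : comNzRingType) (J : R -> Prop) fs f :
  is_ideal J -> f \in fs -> foldl (@ideal_add R) J fs f.
Proof.
elim: fs J => //= g fs IH J iJ; rewrite inE => /predU1P[->|ffs].
  exact/foldl_ideal_add_sub/ideal_add_gen.
by apply: IH => //; apply: ideal_add_ideal.
Qed.

Lemma foldl_ideal_add_min (R : comNzRingType) (J Q : R -> Prop) fs g :
  is_ideal Q -> (forall h, J h -> Q h) -> {in fs, forall f, Q f} ->
  foldl (@ideal_add R) J fs g -> Q g.
Proof.
move=> iQ; have [_ QD QM] := iQ.
elim: fs J => [|f fs IH] J JQ Qfs /=; first exact: JQ.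
apply: IH => [h [a /JQ Qh]|h hfs]; last by apply: Qfs; rewrite inE hfs orbT.
by rewrite -(subrK (a * f) h); apply: QD => //; apply/QM/Qfs/mem_head.
Qed.

Lemma ideal_plus_seqE (K : fieldType) n (I : {mpoly K[n]} -> Prop) fs g :
  is_ideal I -> ideal_plus_seq I fs g <-> foldl (@ideal_add _) I fs g.
Proof.
move=> iI; split.
  apply: gen_ideal_min; first exact: foldl_ideal_add_ideal.
  by move=> h [Ih|hfs]; [apply: foldl_ideal_add_sub|apply: foldl_ideal_add_gen].
apply: foldl_ideal_add_min; first exact: gen_ideal_ideal.
  by move=> h Ih; apply: gen_ideal_gen; left.
by move=> f ffs; apply: gen_ideal_gen; right.
Qed.

Lemma weakly_regularP (R : comNzRingType) (J : R -> Prop) fs :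
  weakly_regular J fs <->
  forall i, (i < size fs)%N ->
    nonzerodiv (foldl (@ideal_add R) J (take i fs)) fs`_i.
Proof.
elim: fs J => [|f fs IH] J /=; first by split.
split=> [[nz /IH reg] [|i] //= lt|reg]; first exact: reg.
by split; [apply: (reg 0%N)|apply/IH => i lt; apply: (reg i.+1)].
Qed.

Lemma weakly_regular_param_chain (R : comNzRingType) (J : R -> Prop) fs :
  is_ideal J -> weakly_regular J fs -> ~ foldl (@ideal_add R) J fs 1 ->
  param_chain J fs.
Proof.
elim: fs J => //= f fs IH J iJ [nz reg] J1; split=> //; exists (ideal_add J f).
split; [exact: ideal_add_ideal|exact: ideal_add_sub|exact: ideal_add_gen|].
by apply: IH => //; apply: ideal_add_ideal.
Qed.

Lemma regular_seq_weakly (K : fieldType) n (I : {mpoly K[n]} -> Prop) fs :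
  is_ideal I -> regular_seq I fs -> weakly_regular I fs.
Proof.
move=> iI [_ reg _]; apply/weakly_regularP=> i lt g.
by rewrite -!ideal_plus_seqE //; apply: reg.
Qed.

Lemma regular_seq_param_chain (K : fieldType) n (I : {mpoly K[n]} -> Prop) fs :
  is_ideal I -> regular_seq I fs -> param_chain I fs.
Proof.
move=> iI reg; apply: weakly_regular_param_chain => //.
  exact: regular_seq_weakly.
by have [_ _] := reg; rewrite ideal_plus_seqE.
Qed.

Lemma max_ideal_mcoeff0 (K : fieldType) n (f : {mpoly K[n]}) :
  max_ideal f -> f@_0%MM = 0.
Proof.
pose J (f : {mpoly K[n]}) := f@_0%MM = 0.
apply: (@gen_ideal_min _ _ _ J).
  split=> [|g h|a g]; rewrite /J ?mcoeff0 //.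
    by rewrite mcoeffD => -> ->; rewrite addr0.
  by move=> g0; rewrite (rmorphM (mcoeff 0%MM)) /= g0 mulr0.
by move=> g [i ->]; rewrite /J mcoeffX mnm1_eq0.
Qed.

(** Properness comes for free: everything lies in the maximal ideal, whose members have no constant
    term. *)
Lemma weakly_regular_regular_seq (K : fieldType) n (I : {mpoly K[n]} -> Prop) fs :
  is_ideal I -> (forall f, I f -> max_ideal f) -> {in fs, forall f, max_ideal f} ->
  weakly_regular I fs -> regular_seq I fs.
Proof.
move=> iI Im fsm reg; split=> //.
  by move=> i lt g; rewrite !ideal_plus_seqE //; apply: (weakly_regularP _ _).1.
rewrite ideal_plus_seqE // => I1.
have /max_ideal_mcoeff0/eqP : max_ideal (1 : {mpoly K[n]}).
  by apply: foldl_ideal_add_min I1 => //; apply: gen_ideal_ideal.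
by rewrite mcoeff1 eqxx oner_eq0.
Qed.

Lemma prime_ideal_ideal (K : fieldType) n (P : {mpoly K[n]} -> Prop) :
  is_prime_ideal P -> is_ideal P.
Proof. by case. Qed.

(** An element of [P 1] outside the prime [P 0] is a nonzerodivisor modulo [P 0], and [P 1] serves
    as the next ideal. *)
Lemma prime_chain_param_chain (K : fieldType) n (I : {mpoly K[n]} -> Prop) d P :
  prime_chain I d P -> exists2 fs, size fs = d & param_chain (P 0%N) fs.
Proof.
elim: d P => [|d IH] P [pr st].
  by exists [::] => //=; have [[]] := pr 0%N isT.
have [|fs sz pc] := IH (fun i => P i.+1).
  by split=> i lt; [apply: pr|apply: st].
have [P01 [f [P1f P0f]]] := st 0%N isT.
have [[_ _ _ _ P0M] _] := pr 0%N isT.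
exists (f :: fs); rewrite /= ?sz //; split=> [g /P0M[]//|].
exists (P 1%N); split=> //; apply: prime_ideal_ideal.
by have [] := pr 1%N isT.
Qed.

(** Phrased through the complement, so that faces of the independence complex and vertex covers
    correspond by definition. *)
Definition stable (n : nat) (e : rel 'I_n) (S : {set 'I_n}) : bool :=
  vertex_cover e (~: S).

Lemma stableP n (e : rel 'I_n) (S : {set 'I_n}) :
  reflect {in S &, forall x y, ~~ e x y} (stable e S).
Proof.
apply: (iffP forallP) => [cov x y xS yS|st x].
  by have /forallP/(_ y) := cov x; rewrite !inE xS yS implybF.
apply/forallP=> y; apply/implyP=> exy; rewrite !inE -negb_and.
by apply: contraL exy => /andP[xS yS]; apply: st.
Qed.

Lemma down_closed_stable n (e : rel 'I_n) : down_closed (stable e).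
Proof.
move=> A B /subsetP AB /stableP sB; apply/stableP=> x y /AB xB /AB yB; exact: sB.
Qed.

(** A monomial whose support contains an edge is divisible by the product of its ends: without loops
    they are distinct, so exponents 1 suffice. *)
Lemma edge_ideal_stable (K : fieldType) n (e : rel 'I_n) f :
  ssrbool.irreflexive e ->
  gen_ideal (@edge_gens K n e) f <-> face_ideal (stable e) f.
Proof.
move=> irr; split.
  apply: gen_ideal_min; first exact/face_ideal_ideal/down_closed_stable.
  move=> g [i [j [eij ->]]]; rewrite -mpolyXD face_idealX mnm_suppD !mnm_suppU.
  by apply/negP=> /stableP/(_ i j); rewrite !inE !eqxx orbT eij => /(_ isT isT).
move=> If; rewrite (mpolyE f).
apply: ideal_sum; first exact: gen_ideal_ideal.
move=> m; rewrite mcoeff_msupp => fm.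
have : ~~ stable e (mnm_supp m) by apply: contra fm => /If->.
rewrite /stable negb_forall => /existsP[i]; rewrite negb_forall => /existsP[j].
rewrite negb_imply negb_or !in_setC !negbK !inE => /and3P[eij mi mj].
have ij : i != j by apply: contraTneq eij => ->; rewrite irr.
have le : (U_(i) + U_(j) <= m)%MM.
  apply/mnm_lepP=> k; rewrite mnmDE !mnm1E.
  have [<-|_] := eqVneq i k; first by rewrite eq_sym (negPf ij) addn0 lt0n.
  by have [<-|_] := eqVneq j k; rewrite ?lt0n.
rewrite -(submK le) mpolyXD -mul_mpolyC mulrA.
have [_ _ GM] := gen_ideal_ideal (@edge_gens K n e); apply/GM/gen_ideal_gen.
by exists i, j; rewrite mpolyXD.
Qed.

(** Removing the vertices of [F] one at a time enlarges [var_ideal] by one variable at each step. *)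
Lemma prime_chain_stable (K : fieldType) n (e : rel 'I_n) (F : {set 'I_n}) :
  ssrbool.irreflexive e -> stable e F ->
  exists P, prime_chain (gen_ideal (@edge_gens K n e)) #|F| P.
Proof.
move=> irr sF; pose Fi i := [set v in drop i (enum F)].
exists (fun i => var_ideal K n (Fi i)); split=> i lt.
  split; first exact: var_ideal_prime.
  move=> f; rewrite edge_ideal_stable //; apply: face_ideal_sub => S SF.
  apply: down_closed_stable sF; apply: subset_trans SF _.
  by apply/subsetP=> v; rewrite inE => /mem_drop; rewrite mem_enum.
rewrite cardE in lt.
have [v0 _] : exists v0 : 'I_n, true by case: (enum F) lt => // v; exists v.
have dE : drop i (enum F) = nth v0 (enum F) i :: drop i.+1 (enum F).
  exact: drop_nth.
have := drop_uniq i (enum_uniq F); rewrite dE /= => /andP[vF _].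
split.
  move=> f; apply: face_ideal_sub => S SF; apply: subset_trans SF _.
  by apply/subsetP=> v; rewrite !inE dE inE => ->; rewrite orbT.
exists 'X_(nth v0 (enum F) i); rewrite !var_idealX !inE dE; split=> //.
by rewrite mem_head.
Qed.

Lemma edge_ideal_max (K : fieldType) n (e : rel 'I_n) f :
  gen_ideal (@edge_gens K n e) f -> max_ideal f.
Proof.
apply: gen_ideal_min; first exact: gen_ideal_ideal.
move=> g [i [j [_ ->]]].
have [_ _ GM] := gen_ideal_ideal (fun g : {mpoly K[n]} => exists i, g = 'X_i).
by apply/GM/gen_ideal_gen; exists j.
Qed.

(** Depth and dimension both equal the size of [F]: [fs] and the chain of variable primes bound them
    below, and [size_param_chain] bounds both above. *)
Lemma CM_graph_weakly_regular (K : fieldType) n (e : rel 'I_n) F fs :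
  ssrbool.irreflexive e -> stable e F ->
  (forall S, stable e S -> (#|S| <= #|F|)%N) ->
  size fs = #|F| -> {in fs, forall f, max_ideal f} ->
  weakly_regular (gen_ideal (@edge_gens K n e)) fs -> CM_graph K e.
Proof.
move=> irr sF maxF szf fsm reg; set I := gen_ideal _ in reg *.
have iI : is_ideal I by apply: gen_ideal_ideal.
have ltn_d J gs : is_ideal J -> (forall g, I g -> J g) -> param_chain J gs ->
    (size gs < #|F|.+1)%N.
  move=> iJ IJ; apply: size_param_chain maxF iJ _ => g.
  by rewrite -edge_ideal_stable //; apply: IJ.
exists #|F|; split; split.
- exists fs; split=> //; apply: weakly_regular_regular_seq => //.
  exact: edge_ideal_max.
- case=> gs [sz /(regular_seq_param_chain iI)/(ltn_d _ _ iI (fun _ => id))].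
  by rewrite sz ltnn.
- exact: prime_chain_stable.
- case=> P pc; have [gs sz] := prime_chain_param_chain pc.
  have [/(_ 0%N isT)[/prime_ideal_ideal iP IP] _] := pc.
  by move/(ltn_d _ _ iP IP); rewrite sz ltnn.
Qed.

Lemma CM_graph_regular_pair (K : fieldType) n (e : rel 'I_n) F :
  ssrbool.irreflexive e -> stable e F -> (1 < #|F|)%N -> CM_graph K e ->
  exists f1 f2 : {mpoly K[n]}, [/\ max_ideal f1, max_ideal f2 &
    weakly_regular (face_ideal (stable e)) [:: f1; f2]].
Proof.
move=> irr sF F1 [d [[[fs [sz reg]] _] [_ dim]]].
have d1 : (1 < d)%N.
  (* Were [d] at most 1, truncating the chain of primes built from [F] would give one of length
     [d.+1]. *)
  rewrite ltnNge; apply/negP=> le_d; have [P [pr st]] := prime_chain_stable K irr sF.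
  have le : (d.+1 <= #|F|)%N by apply: leq_ltn_trans le_d F1.
  apply: dim; exists P; split=> i lt; [apply: pr|apply: st];
    exact: leq_trans le.
have [fsm _ _] := reg.
have := regular_seq_weakly (gen_ideal_ideal _) reg.
case: fs sz fsm {reg} => [|f1 [|f2 fs]] /= sz fsm; try by rewrite -sz in d1.
case=> nz1 [nz2 _]; exists f1, f2; split; try by apply: fsm; rewrite !inE eqxx ?orbT.
refine (@weakly_regular_ext _ [:: f1; f2] (gen_ideal (@edge_gens K n e)) _ _ _).
  by move=> g; rewrite edge_ideal_stable.
by split.
Qed.

Lemma stable_complete_bipartite n (e : rel 'I_n) (P S : {set 'I_n}) :
  stable e P -> stable e (~: P) -> (forall x y, x \in P -> y \notin P -> e x y) ->
  stable e S = (S \subset P) || (S \subset ~: P).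
Proof.
move=> sP sC ePC; apply/idP/orP=> [/stableP sS|[]]; last 2 first.
- by move=> SP; apply: down_closed_stable sP.
- by move=> SP; apply: down_closed_stable sC.
have [|/subsetPn[x xS xP]] := boolP (S \subset P); [by left|right].
apply/subsetP=> y yS; rewrite inE; apply/negP=> yP.
by have := sS y x yS xS; rewrite ePC.
Qed.

(* With [R/I] embedded in [K[P] x K[R]], the [P]-component [p] of a regular
   element [f1] is killed by all variables modulo [f1]; regularity of [f2] would
   put [p] into [(f1)], forcing a multiplier with constant terms 1 and 0. *)
Lemma complete_bipartite_not_CM (K : fieldType) n (e : rel 'I_n) (P : {set 'I_n}) :
  ssrbool.irreflexive e -> stable e P -> stable e (~: P) ->
  (forall x y, x \in P -> y \notin P -> e x y) ->
  (1 < #|P|)%N -> (0 < #|~: P|)%N -> ~ CM_graph K e.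
Proof.
move=> irr sP sC ePC P1 C1 /(CM_graph_regular_pair irr sP P1).
case=> f1 [f2 [/max_ideal_mcoeff0 f10 f2m [nz1 [nz2 _]]]].
set I := face_ideal _ in nz1 nz2.
have IE g : I g <-> var_ideal K n P g /\ var_ideal K n (~: P) g.
  split=> [Ig|[Pg Cg] m].
    by split; apply: face_ideal_sub Ig => S SP;
      rewrite (stable_complete_bipartite _ sP sC ePC) SP ?orbT.
  by rewrite (stable_complete_bipartite _ sP sC ePC) => /orP[/Pg|/Cg].
have iI : is_ideal I by apply/face_ideal_ideal/down_closed_stable.
have [_ _ PM] := var_ideal_ideal K P; have [_ _ CM] := var_ideal_ideal K (~: P).
set p := kill P f1.
have Cp : var_ideal K n (~: P) p.
  move=> m mC; rewrite mcoeff_kill; case: ifP => // mP.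
  suff -> : m = 0%MM by [].
  apply/mnmP=> i; rewrite mnm0E; apply/eqP/negPn/negP=> mi.
  have im : i \in mnm_supp m by rewrite inE.
  by have := subsetP mC _ im; rewrite inE (subsetP mP _ im).
have : ideal_add I f1 (f2 * p).
  have iA := ideal_add_ideal f1 iI; have [A0 AD AM] := iA.
  apply: (gen_ideal_min (J := fun g => ideal_add I f1 (g * p))) f2m.
    split=> [|g h Ag Ah|a g Ag]; first by rewrite mul0r.
      by rewrite mulrDl; apply: AD.
    by rewrite -mulrA; apply: AM.
  move=> _ [v ->]; have [vP|vP] := boolP (v \in P); last first.
    apply: ideal_add_sub; apply/IE; split; last exact: CM.
    by rewrite mulrC; apply/PM/var_idealX.
  (* For [v] in [P], ['X_v * p] and ['X_v * f1] agree modulo [I]: they agree on [P], and ['X_v]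
     vanishes on the other side. *)
  exists 'X_v; apply/IE; split.
    rewrite -mulrBr; apply: PM; rewrite -opprB.
    exact: (idealN (var_ideal_ideal K P) (@kill_id K n P f1)).
  by rewrite -mulrBr mulrC; apply/CM/var_idealX; rewrite inE negbK.
move/nz2=> [h /IE[Ph Ch]].
(* If [f1] vanished on one side, it would annihilate the variables of that side modulo [I]. *)
have f1P : kill P f1 != 0.
  apply/eqP=> /var_ideal_kill Pf1.
  have [v vP] : exists v, v \in P by apply/card_gt0P; apply: ltnW.
  have /IE[/var_idealX] : I 'X_v; last by rewrite vP.
  apply: nz1; apply/IE; split; first by rewrite mulrC; apply: PM.
  by apply/CM/var_idealX; rewrite inE negbK.
have f1C : kill (~: P) f1 != 0.
  apply/eqP=> /var_ideal_kill Cf1.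
  have [v vP] : exists v, v \in ~: P by apply/card_gt0P.
  have /IE[_ /var_idealX] : I 'X_v; last by rewrite vP.
  apply: nz1; apply/IE; split; last by rewrite mulrC; apply: CM.
  by apply/PM/var_idealX; rewrite inE in vP.
have hC : h@_0%MM = 0.
  have /var_ideal_kill/(congr1 (@mcoeff _ _ 0%MM)) : var_ideal K n (~: P) h.
    apply/var_ideal_kill/eqP; have : kill (~: P) (h * f1) == 0.
      apply/eqP/var_ideal_kill; rewrite -[h * f1]opprK -[- (h * f1)](addKr p) opprD opprK.
      exact: (idealB (var_ideal_ideal K _)).
    by rewrite killM mulf_eq0 (negPf f1C) orbF.
  by rewrite mcoeff_kill mnm_supp0 sub0set mcoeff0.
have hP : kill P h = 1.
  apply/(mulIf f1P); rewrite mul1r -killM; apply/mpolyP=> m.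
  rewrite !mcoeff_kill; case: ifP => // mP.
  have := Ph m mP; rewrite mcoeffB mcoeff_kill mP => /eqP.
  by rewrite subr_eq0 => /eqP.
have := congr1 (@mcoeff _ _ 0%MM) hP.
rewrite mcoeff_kill mnm_supp0 sub0set hC mcoeff1 eqxx => /eqP.
by rewrite eq_sym oner_eq0.
Qed.

(** * Bipartite graphs given by posets *)

(* [e (x i) (y j)] is the order relation of the poset, and the order of ['I_d]
   is a linear extension of it. *)
Definition poset_bipartite (n d : nat) (e : rel 'I_n) (x y : 'I_d -> 'I_n) : Prop :=
  [/\ injective x /\ injective y,
      (forall i j, x i != y j) /\
      (forall v, (exists i, v = x i) \/ (exists i, v = y i)),
      (forall i j, ~~ e (x i) (x j)) /\ (forall i j, ~~ e (y i) (y j)),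
      (forall i, e (x i) (y i)) /\ (forall i j, e (x i) (y j) -> (i <= j)%N)
    & forall i j k, e (x i) (y j) -> e (x j) (y k) -> e (x i) (y k)].

Definition above (n d : nat) (e : rel 'I_n) (x y : 'I_d -> 'I_n) (Z : {set 'I_d})
  (i : 'I_d) : bool := [exists z in Z, e (x z) (y i)].

(* The complex left after taking the star of [x z] for [z] in [Z] and deleting
   every other [x i], [i < k], not above [Z]. *)
Definition partial_complex (n d : nat) (e : rel 'I_n) (x y : 'I_d -> 'I_n) (k : nat)
  (Z : {set 'I_d}) (S : {set 'I_n}) : bool :=
  stable e (S :|: x @: Z) &&
  [forall i : 'I_d, (i < k)%N && (x i \in S) ==> above e x y Z i].

Lemma down_closed_partial n d e x y k Z :
  down_closed (@partial_complex n d e x y k Z).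
Proof.
move=> A B AB /andP[sB /forallP uB]; apply/andP; split.
  by apply: down_closed_stable sB; apply: setSU.
apply/forallP=> i; apply/implyP=> /andP[ik iA].
by have := uB i; rewrite ik (subsetP AB).
Qed.

(** Adding [k] to [Z] makes [k] itself above [Z] and changes nothing for smaller indices, because
    the numbering is a linear extension. *)
Lemma partial_complex_star n d e x y (k : 'I_d) Z S :
  @poset_bipartite n d e x y ->
  partial_complex e x y k Z (x k |: S) = partial_complex e x y k.+1 (k |: Z) S.
Proof.
move=> [[xI yI] [xy _] _ [exy ord] _]; congr (stable e _ && _).
  by rewrite imsetU imset_set1 setUCA setUA.
apply: eq_forallb => i; rewrite in_setU1 ltnS (inj_eq xI).
have aboveU : above e x y (k |: Z) i = e (x k) (y i) || above e x y Z i.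
  apply/exists_inP/orP=> [[z]|[ek|/exists_inP[z zZ ez]]].
  - rewrite !inE => /orP[/eqP->|zZ ez]; [by left|right].
    by apply/exists_inP; exists z.
  - by exists k; rewrite ?setU11.
  - by exists z; rewrite // inE zZ orbT.
rewrite aboveU; have [->|ne] := eqVneq i k.
  by rewrite ltnn leqnn exy /= implybT.
have -> : (i <= k)%N = (i < k)%N by rewrite ltn_neqAle -val_eqE /= in ne *; rewrite ne.
have [lt|] := ltnP i k => //=.
have -> // : e (x k) (y i) = false.
by apply/negP=> /ord; rewrite leqNgt lt.
Qed.

Lemma partial_complex_del n d e x y (k : 'I_d) Z S :
  @poset_bipartite n d e x y -> ~~ above e x y Z k ->
  partial_complex e x y k Z S && (x k \notin S) = partial_complex e x y k.+1 Z S.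
Proof.
move=> pb aZ; rewrite /partial_complex -andbA; congr (_ && _).
apply/andP/forallP=> [[/forallP H xk] i|H].
  rewrite ltnS leq_eqVlt; apply/implyP=> /andP[/orP[/eqP/val_inj->|lt] xi].
    by rewrite xi in xk.
  by have := H i; rewrite lt xi.
split; last by apply: contra aZ => xk; have := H k; rewrite ltnS leqnn xk.
apply/forallP=> i; apply/implyP=> /andP[lt xi].
by have := H i; rewrite ltnS (ltnW lt) xi.
Qed.

Lemma partial_complex_skip n d e x y (k : 'I_d) Z S :
  above e x y Z k ->
  @partial_complex n d e x y k Z S = partial_complex e x y k.+1 Z S.
Proof.
move=> aZ; rewrite /partial_complex; congr (_ && _).
apply: eq_forallb => i; rewrite ltnS [(i <= k)%N]leq_eqVlt.
by have [->|ne] := eqVneq i k; [rewrite aZ !implybT|rewrite val_eqE (negPf ne)].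
Qed.

(** The facet left once every index is decided; it contains exactly one end of each matched pair. *)
Definition final_face (n d : nat) (e : rel 'I_n) (x y : 'I_d -> 'I_n)
  (Z : {set 'I_d}) : {set 'I_n} :=
  x @: [set i | above e x y Z i] :|: y @: [set i | ~~ above e x y Z i].

Lemma mem_final_face n d e x y Z i :
  @poset_bipartite n d e x y ->
  (x i \in final_face e x y Z) = above e x y Z i /\
  (y i \in final_face e x y Z) = ~~ above e x y Z i.
Proof.
move=> [[xI yI] [xy _] _ _ _]; rewrite !inE !mem_imset // !inE.
have -> : x i \in y @: [set i0 | ~~ above e x y Z i0] = false.
  by apply/negP=> /imsetP[j _ E]; have := xy i j; rewrite E eqxx.
have -> : y i \in x @: [set i0 | above e x y Z i0] = false.
  by apply/negP=> /imsetP[j _ E]; have := xy j i; rewrite E eqxx.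
by rewrite orbF.
Qed.

(** By transitivity the indices above [Z] form an up-set, so no edge joins an [x i] above [Z] to a
    [y j] not above it. The final face is therefore stable and the complex is a full simplex. *)
Lemma partial_complex_final n d e x y Z S :
  @poset_bipartite n d e x y -> ssrbool.symmetric e ->
  partial_complex e x y d Z S = (S \subset final_face e x y Z).
Proof.
move=> pb sym; have memF := fun i => @mem_final_face n d e x y Z i pb.
case: pb => [[xI yI] [xy surj] [xx yy] [exy ord] tr].
apply/andP/subsetP=> [[/stableP sS /forallP uS] v vS|SF].
  have [[i vE]|[i vE]] := surj v; rewrite vE in vS *.
    by rewrite (memF i).1; have := uS i; rewrite ltn_ord vS.
  rewrite (memF i).2; apply/exists_inP=> -[z zZ ez].
  by have := sS (x z) (y i); rewrite !inE vS imset_f ?orbT // ez => /(_ isT isT).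
have xup i : x i \in S :|: x @: Z -> above e x y Z i.
  rewrite inE => /orP[/SF|/imsetP[z zZ /xI ->]]; first by rewrite (memF i).1.
  by apply/exists_inP; exists z.
have ydown i : y i \in S :|: x @: Z -> ~~ above e x y Z i.
  rewrite inE => /orP[/SF|/imsetP[z zZ E]]; first by rewrite (memF i).2.
  by have := xy z i; rewrite E eqxx.
have xyst i j : x i \in S :|: x @: Z -> y j \in S :|: x @: Z -> ~~ e (x i) (y j).
  move=> /xup/exists_inP[z zZ ez] /ydown; apply: contra => eij.
  by apply/exists_inP; exists z => //; apply: tr eij.
split; last first.
  by apply/forallP=> i; apply/implyP=> /andP[_ xS]; apply: xup; rewrite inE xS.
apply/stableP=> u v uS vS.
have [[i uE]|[i uE]] := surj u; have [[j vE]|[j vE]] := surj v; subst u v => //.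
  exact: xyst.
by rewrite sym; apply: xyst.
Qed.

(** The [x k] are decided in increasing order, [r] of them remaining. An index above [Z] needs no
    decision; any other splits into star and deletion, and every branch ends in a simplex. *)
Lemma poset_bipartite_weakly_regular (K : fieldType) n d e x y :
  @poset_bipartite n d e x y -> ssrbool.symmetric e ->
  weakly_regular (@face_ideal K n (stable e))
    [seq 'X_(x i) + 'X_(y i) | i <- enum 'I_d].
Proof.
move=> pb sym; set fs := [seq _ | i <- _].
have step r k Z : (k + r = d)%N ->
    weakly_regular (@face_ideal K n (partial_complex e x y k Z)) fs.
  elim: r k Z => [|r IH] k Z.
    rewrite addn0 => ->.
    apply: (@weakly_regular_ext _ _ (var_ideal K n (final_face e x y Z))).
      by move=> g; apply: face_ideal_ext => S; rewrite partial_complex_final.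
    have [[xI yI] [xy _] _ _ _] := pb.
    apply: weakly_regular_var_ideal => //; first exact: enum_uniq.
    by move=> i _; have [-> ->] := mem_final_face Z i pb; rewrite negbK.
  move=> kd; have lt : (k < d)%N by rewrite -kd -addSnnS leq_addr.
  pose k' := Ordinal lt; rewrite -[k]/(val k') /=.
  have [aZ|aZ] := boolP (above e x y Z k').
    apply: weakly_regular_ext (IH k.+1 Z _); last by rewrite addSnnS.
    by move=> g; apply: face_ideal_ext => S; rewrite (partial_complex_skip _ aZ).
  apply: (weakly_regular_vertex (v := x k')); first exact: down_closed_partial.
    apply: weakly_regular_ext (IH k.+1 (k' |: Z) _); last by rewrite addSnnS.
    by move=> g; apply: face_ideal_ext => S; rewrite (partial_complex_star k').
  apply: weakly_regular_ext (IH k.+1 Z _); last by rewrite addSnnS.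
  by move=> g; apply: face_ideal_ext => S; rewrite (partial_complex_del _ pb aZ).
apply: weakly_regular_ext (step d 0%N set0 (add0n d)) => g.
apply: face_ideal_ext => S; rewrite /partial_complex imset0 setU0.
by rewrite (introT forallP) ?andbT.
Qed.

Lemma poset_bipartite_CM (K : fieldType) n d e x y :
  @poset_bipartite n d e x y -> simple_graph e -> CM_graph K e.
Proof.
move=> pb [sym irr]; have [[xI yI] [xy surj] [xx yy] [exy _] _] := pb.
have cF : #|[set x i | i : 'I_d]| = d by rewrite card_imset ?card_ord.
apply: (@CM_graph_weakly_regular K n e [set x i | i : 'I_d]
   [seq 'X_(x i) + 'X_(y i) | i <- enum 'I_d]) => //.
- by apply/stableP=> _ _ /imsetP[i _ ->] /imsetP[j _ ->].
- move=> S /stableP sS; rewrite cF.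
  (* A stable set contains at most one end of each matched edge, and [f] selects it. *)
  pose f i := if x i \in S then x i else y i.
  apply: leq_trans (_ : #|f @: [set: 'I_d]| <= _)%N; last first.
    by apply: leq_trans (leq_imset_card _ _) _; rewrite cardsT card_ord.
  apply/subset_leq_card/subsetP=> v vS; apply/imsetP.
  have [[i E]|[i E]] := surj v; subst v; exists i; rewrite ?inE // /f ?vS //.
  by case: ifP => // xS; have := sS _ _ xS vS; rewrite exy.
- by rewrite size_map size_enum_ord cF.
- move=> f /mapP[i _ ->].
  have [_ GD _] := gen_ideal_ideal (fun g : {mpoly K[n]} => exists i, g = 'X_i).
  by apply: GD; apply: gen_ideal_gen; [exists (x i)|exists (y i)].
- apply: weakly_regular_ext (poset_bipartite_weakly_regular K pb sym) => g.
  by rewrite edge_ideal_stable.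
Qed.

(** * Minimal vertex covers *)

Lemma vertex_coverP n (e : rel 'I_n) (C : {set 'I_n}) :
  reflect (forall x y, e x y -> x \notin C -> y \in C) (vertex_cover e C).
Proof.
apply: (iffP forallP) => [cov x y exy xC|cov x].
  by have /forallP/(_ y) := cov x; rewrite exy (negPf xC).
by apply/forallP=> y; apply/implyP=> /cov; case: (x \in C) => //= ->.
Qed.

Lemma min_vertex_coverP n (e : rel 'I_n) (C : {set 'I_n}) :
  simple_graph e ->
  reflect (vertex_cover e C /\ forall x, x \in C -> exists2 y, y \notin C & e x y)
    (min_vertex_cover e C).
Proof.
move=> [sym irr]; apply: (iffP minsetP) => -[cov mn]; split=> //.
  move=> x xC; have [/exists_inP//|] := boolP [exists (y | y \notin C), e x y].
  rewrite negb_exists_in => /forall_inP nx.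
  suff E : C :\ x = C by move: xC; rewrite -E setD11.
  apply: mn; last exact: subD1set.
  have nb z : e x z -> z != x /\ z \in C.
    move=> exz; have zC : z \in C by apply: contraTT exz => /nx.
    by split=> //; apply: contraTneq exz => ->; rewrite irr.
  apply/vertex_coverP=> u v euv; rewrite !inE negb_and negbK.
  case/orP=> [/eqP ux|uC]; first by rewrite ux in euv; have [-> ->] := nb v euv.
  rewrite (vertex_coverP _ _ cov u v) // andbT; apply: contraNneq uC => vx.
  by rewrite vx sym in euv; have [] := nb u euv.
move=> B covB BC; apply/eqP; rewrite eqEsubset BC /=; apply/subsetP=> x /mn[y yC exy].
by rewrite (vertex_coverP _ _ covB y x) 1?sym //; apply: contra yC; apply: (subsetP BC).
Qed.

Lemma min_vertex_cover_cover n (e : rel 'I_n) (C : {set 'I_n}) :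
  min_vertex_cover e C -> vertex_cover e C.
Proof. by case/minsetP. Qed.

Lemma min_vertex_cover_nonedge n (e : rel 'I_n) (C : {set 'I_n}) x y :
  min_vertex_cover e C -> x \notin C -> y \notin C -> ~~ e x y.
Proof.
move=> /min_vertex_cover_cover/vertex_coverP cov xC yC; apply/negP=> exy.
by rewrite (cov x y) in yC.
Qed.

Lemma min_vertex_cover_exists n (e : rel 'I_n) (C : {set 'I_n}) :
  vertex_cover e C -> exists2 D, min_vertex_cover e D & D \subset C.
Proof. by move=> /minset_exists[D mD DC]; exists D. Qed.

Lemma unmixed_min_vertex_cover n (e : rel 'I_n) (C D : {set 'I_n}) :
  unmixed e -> min_vertex_cover e C -> vertex_cover e D -> #|D| = #|C| ->
  min_vertex_cover e D.
Proof.
move=> um mC /min_vertex_cover_exists[D' mD' sD] cD.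
suff <- : D' = D by [].
by apply/eqP; rewrite eqEcard sD cD (um _ _ mC mD') leqnn.
Qed.

Lemma card_setD_eq (T : finType) (A B : {set T}) :
  #|A| = #|B| -> #|A :\: B| = #|B :\: A|.
Proof.
move=> AB; apply/eqP; rewrite -(eqn_add2l #|A :&: B|) cardsID.
by rewrite setIC cardsID AB.
Qed.

(** * Swaps between minimal covers, and the bipartite case *)

Definition no_complete_diff (n : nat) (e : rel 'I_n) : Prop :=
  forall C1 C2 : {set 'I_n}, min_vertex_cover e C1 -> min_vertex_cover e C2 ->
    (1 < #|C1 :\: C2|)%N ->
    exists x y, [/\ x \in C1 :\: C2, y \in C2 :\: C1 & ~~ e x y].

Lemma min_vertex_cover_between n (e : rel 'I_n) (C1 C2 : {set 'I_n}) :
  simple_graph e -> unmixed e -> no_complete_diff e ->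
  min_vertex_cover e C1 -> min_vertex_cover e C2 -> (1 < #|C1 :\: C2|)%N ->
  exists D, [/\ min_vertex_cover e D, D \subset C1 :|: C2,
    (#|C1 :\: D| < #|C1 :\: C2|)%N & (#|D :\: C2| < #|C1 :\: C2|)%N].
Proof.
move=> [sym irr] um nK m1 m2 gt1; have [x [y [xC yC exy]]] := nK _ _ m1 m2 gt1.
move: (xC) (yC); rewrite !inE => /andP[x2 x1] /andP[y1 y2].
have cov1 := vertex_coverP _ _ (min_vertex_cover_cover m1).
have cov2 := vertex_coverP _ _ (min_vertex_cover_cover m2).
have [D mD /subsetP sD] : exists2 D, min_vertex_cover e D &
    (* Neighbours of [x] lie in [C2] and differ from [y]; symmetrically for [y]. A vertex outside
       [C1] or [C2] is handled by the fact that all its neighbours lie in that cover. *)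
    D \subset (C1 :|: C2) :\: [set x; y].
  apply: min_vertex_cover_exists; apply/vertex_coverP=> u v euv.
  have euv' : e v u by rewrite sym.
  have uv : u != v by apply: contraTneq euv => ->; rewrite irr.
  rewrite !inE !(negb_and, negb_or, negbK) => /orP[/orP[]/eqP ?|/andP[u1 u2]].
  - subst u; rewrite eq_sym (negPf uv) /= (cov2 x v) // orbT andbT.
    by apply: contraNneq exy => <-.
  - subst u; rewrite (eq_sym v y) (negPf uv) (cov1 y v) //= !andbT.
    by apply: contraNneq exy => <-.
  - rewrite (cov1 u v) // andbT; apply/andP; split.
      by apply: contraNneq u2 => vx; rewrite (cov2 v u) // vx.
    by apply: contraNneq u1 => vy; rewrite (cov1 v u) // vy.
have sDU : D \subset C1 :|: C2 by apply/subsetP=> v /sD; rewrite inE => /andP[].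
have [xD yD] : x \notin D /\ y \notin D.
  by split; apply/negP=> /sD; rewrite !inE eqxx ?orbT.
exists D; split=> //.
  (* Equal sizes allow counting on the other side, where [D :\: C1] misses [y]. *)
  rewrite (card_setD_eq (um _ _ m1 mD)) (card_setD_eq (um _ _ m1 m2)).
  apply: proper_card; apply/properP; split; last first.
    by exists y => //; rewrite inE (negPf yD) andbF.
  apply/subsetP=> v; rewrite !inE => /andP[v1 /(subsetP sDU)].
  by rewrite inE (negPf v1).
apply: proper_card; apply/properP; split; last first.
  by exists x => //; rewrite inE (negPf xD) andbF.
apply/subsetP=> v; rewrite !inE => /andP[v2 /(subsetP sDU)].
by rewrite inE (negPf v2) orbF.
Qed.

(* The pairs of a maximal chain of elementary swaps [C1 = D_0, D_1, ..., D_k = C2]: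
   the [i]-th swap removes [s_i.2] from the cover and inserts [s_i.1]. *)
Definition swap_list (n : nat) (e : rel 'I_n) (C1 C2 : {set 'I_n})
  (s : seq ('I_n * 'I_n)) : Prop :=
  [/\ uniq (unzip1 s) /\ unzip1 s =i C2 :\: C1,
      uniq (unzip2 s) /\ unzip2 s =i C1 :\: C2,
      {in s, forall a, e a.1 a.2} &
      pairwise (fun a b : 'I_n * 'I_n => ~~ e b.1 a.2) s].

(** A vertex inserted after [D] and a vertex removed before [D] both lie outside [D], hence are
    nonadjacent. *)
Lemma swap_list_cat n (e : rel 'I_n) (C1 D C2 : {set 'I_n}) s1 s2 :
  min_vertex_cover e D -> C1 :&: C2 \subset D -> D \subset C1 :|: C2 ->
  swap_list e C1 D s1 -> swap_list e D C2 s2 -> swap_list e C1 C2 (s1 ++ s2).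
Proof.
move=> mD /subsetP ID /subsetP DU [[u1 E1] [v1 F1] e1 p1] [[u2 E2] [v2 F2] e2 p2].
split.
- rewrite /unzip1 map_cat cat_uniq u1 u2 andbT; split.
    apply/hasPn=> v; rewrite [_ \in _]E2 inE => /andP[vD _].
    by change (v \notin unzip1 s1); rewrite E1 inE (negPf vD) andbF.
  move=> v; rewrite mem_cat [_ \in map _ s1]E1 [_ \in map _ s2]E2 !inE.
  have := ID v; have := DU v; rewrite !inE.
  by case: (v \in C1); case: (v \in C2); case: (v \in D) => //= A B;
    first [have := A isT | have := B isT].
- rewrite /unzip2 map_cat cat_uniq v1 v2 andbT; split.
    apply/hasPn=> v; rewrite [_ \in _]F2 inE => /andP[_ vD].
    by change (v \notin unzip2 s1); rewrite F1 inE vD.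
  move=> v; rewrite mem_cat [_ \in map _ s1]F1 [_ \in map _ s2]F2 !inE.
  have := ID v; have := DU v; rewrite !inE.
  by case: (v \in C1); case: (v \in C2); case: (v \in D) => //= A B;
    first [have := A isT | have := B isT].
- by move=> a; rewrite mem_cat => /orP[/e1|/e2].
- rewrite pairwise_cat p1 p2 !andbT; apply/allrelP=> a b as1 bs2.
  apply: (min_vertex_cover_nonedge mD).
    have : b.1 \in unzip1 s2 by apply: map_f.
    by rewrite E2 inE => /andP[].
  have : a.2 \in unzip2 s1 by apply: map_f.
  by rewrite F1 inE => /andP[].
Qed.

(** The two inclusions say that the passage from [C1] to [C2] only inserts vertices of [P] and
    removes vertices outside [P]; both halves of a split inherit this. *)
Lemma swap_list_exists n (e : rel 'I_n) (P C1 C2 : {set 'I_n}) :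
  simple_graph e -> unmixed e -> no_complete_diff e ->
  vertex_cover e P -> vertex_cover e (~: P) ->
  min_vertex_cover e C1 -> min_vertex_cover e C2 ->
  C1 :&: P \subset C2 -> C2 :\: P \subset C1 ->
  exists s, swap_list e C1 C2 s.
Proof.
move=> sg um nK /vertex_coverP covP /vertex_coverP covC.
have [sym irr] := sg.
have [k] := ubnP #|C1 :\: C2|; elim: k C1 C2 => // k IH C1 C2 lt_k m1 m2 sP sC.
have c12 := card_setD_eq (um _ _ m1 m2).
have [gt1|] := ltnP 1 #|C1 :\: C2|.
  have [D [mD DU lt1 lt2]] := min_vertex_cover_between sg um nK m1 m2 gt1.
  (* A common vertex missing from [D] would have no neighbour outside both covers; but minimality of
     [C1] or of [C2], according to the side of [v], provides one. *)
  have ID : C1 :&: C2 \subset D.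
    apply/subsetP=> v; rewrite inE => /andP[v1 v2]; apply/negPn/negP=> vD.
    have no_w w : e v w -> w \notin C1 -> w \notin C2 -> false.
      move=> evw w1 w2; have := min_vertex_cover_nonedge mD vD (y := w).
      rewrite evw; apply; apply/negP=> /(subsetP DU).
      by rewrite inE (negPf w1) (negPf w2).
    have [vP|vP] := boolP (v \in P).
      have [_ /(_ v v1)[w w1 evw]] := min_vertex_coverP _ sg m1.
      have wP : w \in ~: P by apply: covC evw _; rewrite inE negbK.
      suff : w \notin C2 by move/(no_w w evw w1).
      apply: contra w1 => w2; apply: (subsetP sC); rewrite inE w2 andbT.
      by rewrite inE in wP.
    have [_ /(_ v v2)[w w2 evw]] := min_vertex_coverP _ sg m2.
    have wP : w \in P by apply: covP evw _.
    suff w1 : w \notin C1 by have := no_w w evw w1 w2.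
    by apply: contra w2 => w1; apply: (subsetP sP); rewrite inE w1.
  have [s1 S1] : exists s, swap_list e C1 D s.
    apply: IH => //; first exact: leq_trans lt1 lt_k.
      apply/subsetP=> v; rewrite inE => /andP[v1 vP]; apply: (subsetP ID).
      by rewrite inE v1; apply: (subsetP sP); rewrite inE v1.
    apply/subsetP=> v; rewrite inE => /andP[vP vD].
    have := subsetP DU v vD; rewrite inE => /orP[//|v2].
    by apply: (subsetP sC); rewrite inE vP.
  have [s2 S2] : exists s, swap_list e D C2 s.
    apply: IH => //; first exact: leq_trans lt2 lt_k.
      apply/subsetP=> v; rewrite inE => /andP[vD vP].
      have := subsetP DU v vD; rewrite inE => /orP[v1|//].
      by apply: (subsetP sP); rewrite inE v1.
    apply/subsetP=> v; rewrite inE => /andP[vP v2]; apply: (subsetP ID).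
    by rewrite inE v2 andbT; apply: (subsetP sC); rewrite inE vP.
  by exists (s1 ++ s2); apply: swap_list_cat S1 S2.
rewrite leq_eqVlt => /orP[/cards1P[r rE]|]; last first.
  rewrite ltnS leqn0 => z1; have z2 := z1; rewrite c12 in z2.
  rewrite !cards_eq0 in z1 z2.
  by exists [::]; split=> //; split=> // v; rewrite ?(eqP z1) ?(eqP z2) inE.
have /eqP/cards1P[p pE] : #|C2 :\: C1| = 1%N by rewrite -c12 rE cards1.
exists [:: (p, r)]; split=> //=.
- by split=> // v; rewrite pE !inE.
- by split=> // v; rewrite rE !inE.
move=> _ /[!inE]/eqP-> /=.
have := set11 r; rewrite -rE inE => /andP[r2 r1].
have [_ /(_ r r1)[w w1 erw]] := min_vertex_coverP _ sg m1.
have w2 := vertex_coverP _ _ (min_vertex_cover_cover m2) _ _ erw r2.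
have : w \in C2 :\: C1 by rewrite inE w1.
by rewrite pE inE => /eqP<-; rewrite sym.
Qed.

Lemma bipartite_CM (K : fieldType) n (e : rel 'I_n) (P : {set 'I_n}) :
  simple_graph e -> unmixed e -> no_complete_diff e ->
  min_vertex_cover e P -> min_vertex_cover e (~: P) -> CM_graph K e.
Proof.
move=> sg um nK mP mC; have [sym irr] := sg.
have covP := min_vertex_cover_cover mP; have covC := min_vertex_cover_cover mC.
have [s [[u1 E1] [u2 E2] es ps]] : exists s, swap_list e (~: P) P s.
  apply: (swap_list_exists (P := P)) => //.
    by rewrite setIC setICr sub0set.
  by rewrite setDv sub0set.
have {}E1 : unzip1 s =i P by move=> v; rewrite E1 !inE negbK andbb.
have {}E2 : unzip2 s =i ~: P by move=> v; rewrite E2 !inE andbb.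
pose x (i : 'I_(size s)) := (tnth (in_tuple s) i).1.
pose y (i : 'I_(size s)) := (tnth (in_tuple s) i).2.
have xP i : x i \in P by rewrite -E1; apply/map_f/(mem_tnth i (in_tuple s)).
have yP i : y i \in ~: P by rewrite -E2; apply/map_f/(mem_tnth i (in_tuple s)).
have sz1 : size (unzip1 s) = size s by rewrite size_map.
have sz2 : size (unzip2 s) = size s by rewrite size_map.
have xI : injective x.
  move=> i j; have v0 : 'I_n := x i; rewrite /x !(tnth_nth (v0, v0)) /= => E.
  apply/val_inj/eqP; rewrite -(nth_uniq v0 _ _ u1) ?sz1 ?ltn_ord //.
  by rewrite !(nth_map (v0, v0)) //= E.
have yI : injective y.
  move=> i j; have v0 : 'I_n := y i; rewrite /y !(tnth_nth (v0, v0)) /= => E.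
  apply/val_inj/eqP; rewrite -(nth_uniq v0 _ _ u2) ?sz2 ?ltn_ord //.
  by rewrite !(nth_map (v0, v0)) //= E.
have surj v : (exists i, v = x i) \/ (exists i, v = y i).
  have [vP|vP] := boolP (v \in P).
    left; move: vP; rewrite -E1 => /mapP[a /(tnthP (in_tuple s))[i ->] ->].
    by exists i.
  right; have : v \in unzip2 s by rewrite E2 inE.
  by move=> /mapP[a /(tnthP (in_tuple s))[i ->] ->]; exists i.
have exy i : e (x i) (y i) by apply/es/(mem_tnth i (in_tuple s)).
apply: (@poset_bipartite_CM K n (size s) e x y) => //; split=> //.
- split=> // i j; apply/eqP=> E; by have := yP j; rewrite -E inE xP.
- split=> i j; first by apply: (min_vertex_cover_nonedge mC); rewrite inE negbK.
  by apply: (min_vertex_cover_nonedge mP); have := yP i; have := yP j; rewrite !inE.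
- split=> // i j eij; rewrite leqNgt; apply/negP=> lt.
  have v0 : 'I_n := x i.
  have /(pairwiseP (v0, v0)) := ps => /(_ j i (ltn_ord _) (ltn_ord _) lt).
  by rewrite -!(tnth_nth _ (in_tuple s)) eij.
(* Transitivity: a minimal cover avoiding [x i] and [y k] contains both [x j] and [y j], so its
   complement loses the pair [j] and is too small for an unmixed graph. *)
move=> i j k eij ejk; apply/negPn/negP=> nik.
have cov : vertex_cover e (~: [set x i; y k]).
  rewrite -/(stable e _); apply/stableP=> u v; rewrite !inE.
  by move=> /orP[]/eqP-> /orP[]/eqP->; rewrite ?irr // sym.
have [D mD sD] := min_vertex_cover_exists cov.
have [xD yD] : x i \notin D /\ y k \notin D.
  by split; apply/negP=> /(subsetP sD); rewrite !inE eqxx ?orbT.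
have covD := vertex_coverP _ _ (min_vertex_cover_cover mD).
have yjD : y j \in D by apply: covD eij _.
have xjD : x j \in D by apply: covD yD; rewrite sym.
pose f l := if x l \in D then y l else x l.
have : (#|~: D| <= #|f @: [set~ j]|)%N.
  apply/subset_leq_card/subsetP=> v; rewrite inE => vD; apply/imsetP.
  have [[l E]|[l E]] := surj v; subst v; exists l; rewrite ?inE /f ?(negPf vD) //.
  - by apply: contraNneq vD => ->.
  - by apply: contraNneq vD => ->.
  - by rewrite (covD (y l) (x l)) // sym.
have cD : #|D| = #|P| by apply: um.
have cC : #|~: P| = size s by rewrite -(size_map snd) -(card_uniqP u2); apply/esym/eq_card.
have -> : #|~: D| = size s.
  by apply/eqP; rewrite -(eqn_add2l #|D|) cardsC {1}cD -cC cardsC.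
move/leq_trans/(_ (leq_imset_card _ _)); rewrite cardsC1 card_ord leqNgt.
by rewrite prednK ?leqnn // (leq_ltn_trans _ (ltn_ord j)).
Qed.

(** * Subgraphs induced on symmetric differences *)

Lemma in_symdiff (T : finType) (A B : {set T}) v :
  (v \in symdiff A B) = (v \in A) (+) (v \in B).
Proof. by rewrite !inE; case: (v \in A); case: (v \in B). Qed.

Lemma induced_simple s (e : rel 'I_s) (L : {set 'I_s}) :
  simple_graph e -> simple_graph (induced e L).
Proof. by move=> [sym irr]; split=> [i j|i]; rewrite /induced. Qed.

Lemma enum_val_exists (T : finType) (A : {set T}) v :
  v \in A -> exists i : 'I_#|A|, v = enum_val i.
Proof. by move=> vA; exists (enum_rank_in vA v); rewrite enum_rankK_in. Qed.

Definition trace (s : nat) (L C : {set 'I_s}) : {set 'I_#|L|} :=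
  [set i | enum_val i \in C].

Lemma trace_symdiffC s (C1 C2 : {set 'I_s}) :
  ~: trace (symdiff C1 C2) C1 = trace (symdiff C1 C2) C2.
Proof.
apply/setP=> i; rewrite !inE; have := enum_valP i; rewrite in_symdiff.
by case: (_ \in C1); case: (_ \in C2).
Qed.

(** A neighbour outside [C1] of a vertex of [C1 :\: C2] must lie in [C2], hence in the symmetric
    difference. *)
Lemma min_vertex_cover_trace s (e : rel 'I_s) (C1 C2 : {set 'I_s}) :
  simple_graph e -> min_vertex_cover e C1 -> min_vertex_cover e C2 ->
  min_vertex_cover (induced e (symdiff C1 C2)) (trace (symdiff C1 C2) C1) /\
  min_vertex_cover (induced e (symdiff C1 C2)) (trace (symdiff C1 C2) C2).
Proof.
move=> sg m1 m2; have [sym irr] := sg; set L := symdiff C1 C2.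
have [cov1 mn1] := min_vertex_coverP _ sg m1.
have [cov2 mn2] := min_vertex_coverP _ sg m2.
have sgL := induced_simple L sg.
split; apply/(min_vertex_coverP _ sgL); split.
- by apply/vertex_coverP=> i j eij; rewrite !inE; apply: (vertex_coverP _ _ cov1).
- move=> i; rewrite inE => i1; have [y y1 eiy] := mn1 _ i1.
  have i2 : enum_val i \notin C2 by have := enum_valP i; rewrite in_symdiff i1.
  have y2 := vertex_coverP _ _ cov2 _ _ eiy i2.
  have [j jE] : exists j : 'I_#|L|, y = enum_val j.
    by apply: enum_val_exists; rewrite in_symdiff (negPf y1) y2.
  by exists j; rewrite ?inE /induced -?jE.
- by apply/vertex_coverP=> i j eij; rewrite !inE; apply: (vertex_coverP _ _ cov2).
- move=> i; rewrite inE => i2; have [y y2 eiy] := mn2 _ i2.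
  have i1 : enum_val i \notin C1.
    by have := enum_valP i; rewrite in_symdiff i2 addbT.
  have y1 := vertex_coverP _ _ cov1 _ _ eiy i1.
  have [j jE] : exists j : 'I_#|L|, y = enum_val j.
    by apply: enum_val_exists; rewrite in_symdiff (negPf y2) y1.
  by exists j; rewrite ?inE /induced -?jE.
Qed.

Definition lift_cover (s : nat) (C1 C2 : {set 'I_s})
  (M : {set 'I_#|symdiff C1 C2|}) : {set 'I_s} :=
  C1 :&: C2 :|: [set enum_val i | i in M].

Lemma mem_lift_cover s (C1 C2 : {set 'I_s}) M i :
  (enum_val i \in @lift_cover s C1 C2 M) = (i \in M).
Proof.
rewrite !inE mem_imset; last exact: enum_val_inj.
by have := enum_valP i; rewrite in_symdiff; case: (_ \in C1); case: (_ \in C2).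
Qed.

Lemma card_lift_cover s (C1 C2 : {set 'I_s}) M :
  #|@lift_cover s C1 C2 M| = (#|C1 :&: C2| + #|M|)%N.
Proof.
rewrite cardsU (card_imset _ enum_val_inj).
suff -> : (C1 :&: C2) :&: [set enum_val i | i in M] = set0 by rewrite cards0 subn0.
apply/eqP/set0Pn=> -[v]; rewrite !inE => /andP[v12 /imsetP[i _ vE]].
by have := enum_valP i; rewrite -vE in_symdiff; case/andP: v12 => -> ->.
Qed.

Lemma lift_cover_trace s (C1 C2 : {set 'I_s}) :
  lift_cover (trace (symdiff C1 C2) C1) = C1 /\
  lift_cover (trace (symdiff C1 C2) C2) = C2.
Proof.
split; apply/setP=> v; rewrite !inE.
  have [v1|v1] := boolP (v \in C1); last first.
    by apply/negP=> /imsetP[i]; rewrite inE => i1 E; rewrite E i1 in v1.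
  have [//|v2] := boolP (v \in C2); have [|i vE] := @enum_val_exists _ (symdiff C1 C2) v.
    by rewrite in_symdiff v1 (negPf v2).
  by apply/imsetP; exists i; rewrite // inE -vE.
have [v2|v2] := boolP (v \in C2); last first.
  by rewrite andbF; apply/negP=> /imsetP[i]; rewrite inE => i1 E; rewrite E i1 in v2.
have [//|v1] := boolP (v \in C1); have [|i vE] := @enum_val_exists _ (symdiff C1 C2) v.
  by rewrite in_symdiff v2 (negPf v1).
by apply/imsetP; exists i; rewrite // inE -vE.
Qed.

(** A vertex outside both the lift and the symmetric difference avoids both covers, so its
    neighbours lie in [C1 :&: C2]. *)
Lemma vertex_cover_lift s (e : rel 'I_s) (C1 C2 : {set 'I_s}) M :
  simple_graph e -> vertex_cover e C1 -> vertex_cover e C2 ->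
  vertex_cover (induced e (symdiff C1 C2)) M -> vertex_cover e (lift_cover M).
Proof.
move=> [sym irr] /vertex_coverP cov1 /vertex_coverP cov2 /vertex_coverP covM.
have side u w : e u w -> u \notin lift_cover M -> u \notin symdiff C1 C2 ->
    w \in lift_cover M.
  move=> euw; rewrite inE negb_or inE negb_and in_symdiff => /andP[u12 _] uL.
  have [u1 u2] : u \notin C1 /\ u \notin C2.
    by move: u12 uL; case: (u \in C1); case: (u \in C2).
  by rewrite inE inE (cov1 u w) // (cov2 u w).
apply/vertex_coverP=> u w euw uM; apply/negPn/negP=> wM.
have [/enum_val_exists[i uE]|uL] := boolP (u \in symdiff C1 C2); last first.
  by rewrite (side u w) in wM.
have [/enum_val_exists[j wE]|wL] := boolP (w \in symdiff C1 C2); last first.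
  by rewrite (side w u) // sym in uM.
move: uM wM; rewrite uE wE !mem_lift_cover => iM.
by rewrite (covM i j) // /induced -uE -wE.
Qed.

(** Unmixedness of the induced graph gives the lift the size of [C1], and a cover of that size is
    minimal. *)
Lemma min_vertex_cover_lift s (e : rel 'I_s) (C1 C2 : {set 'I_s}) M :
  simple_graph e -> unmixed e -> unmixed (induced e (symdiff C1 C2)) ->
  min_vertex_cover e C1 -> min_vertex_cover e C2 ->
  min_vertex_cover (induced e (symdiff C1 C2)) M -> min_vertex_cover e (lift_cover M).
Proof.
move=> sg um umL m1 m2 mM; apply: (unmixed_min_vertex_cover um m1).
  by apply: vertex_cover_lift => //; apply: min_vertex_cover_cover.
have [mt _] := min_vertex_cover_trace sg m1 m2.
by rewrite -{2}(lift_cover_trace C1 C2).1 !card_lift_cover (umL _ _ mM mt).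
Qed.

Lemma no_complete_diff_induced s (e : rel 'I_s) (C1 C2 : {set 'I_s}) :
  simple_graph e -> unmixed e -> unmixed (induced e (symdiff C1 C2)) ->
  min_vertex_cover e C1 -> min_vertex_cover e C2 ->
  no_complete_diff e -> no_complete_diff (induced e (symdiff C1 C2)).
Proof.
move=> sg um umL m1 m2 nK M1 M2 mM1 mM2 gt1.
have liftD (A B : {set 'I_#|symdiff C1 C2|}) :
    lift_cover A :\: lift_cover B = [set enum_val i | i in A :\: B].
  apply/setP=> v; apply/setDP/imsetP=> [[vA vB]|[i]]; last first.
    by rewrite inE => /andP[iB iA] ->; rewrite !mem_lift_cover.
  move: (vA); rewrite inE => /orP[v12|/imsetP[i iA vE]].
    by rewrite inE v12 in vB.
  by exists i => //; rewrite inE iA andbT; rewrite vE mem_lift_cover in vB.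
have mL1 := min_vertex_cover_lift sg um umL m1 m2 mM1.
have mL2 := min_vertex_cover_lift sg um umL m1 m2 mM2.
have [|x [y []]] := nK _ _ mL1 mL2.
  by rewrite liftD card_imset //; apply: enum_val_inj.
by rewrite !liftD => /imsetP[i iM ->] /imsetP[j jM ->] eij; exists i, j.
Qed.

Lemma induced_symdiff_CM (K : fieldType) s (e : rel 'I_s) (C1 C2 : {set 'I_s}) :
  simple_graph e -> unmixed e -> no_complete_diff e ->
  min_vertex_cover e C1 -> min_vertex_cover e C2 ->
  unmixed (induced e (symdiff C1 C2)) -> CM_graph K (induced e (symdiff C1 C2)).
Proof.
move=> sg um nK m1 m2 umL; have [t1 t2] := min_vertex_cover_trace sg m1 m2.
apply: (bipartite_CM K (induced_simple _ sg) umL _ t1).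
  exact: no_complete_diff_induced.
by rewrite trace_symdiffC.
Qed.

Lemma nonedge_or_complete (T : finType) (e : rel T) (A B : {set T}) :
  (exists x y, [/\ x \in A, y \in B & ~~ e x y]) \/ {in A & B, forall x y, e x y}.
Proof.
have [/exists_inP[x xA /exists_inP[y yB exy]]|] :=
    boolP [exists x in A, exists y in B, ~~ e x y]; first by left; exists x, y.
rewrite negb_exists_in => /forall_inP nA; right=> x y /nA.
by rewrite negb_exists_in => /forall_inP nB /nB; rewrite negbK.
Qed.

Lemma no_complete_diff_CM (K : fieldType) s (e : rel 'I_s) :
  simple_graph e -> unmixed e ->
  (forall C1 C2 : {set 'I_s}, min_vertex_cover e C1 -> min_vertex_cover e C2 ->
     C1 != C2 -> unmixed (induced e (symdiff C1 C2)) ->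
     CM_graph K (induced e (symdiff C1 C2))) ->
  no_complete_diff e.
Proof.
move=> sg um CM C1 C2 m1 m2 gt1.
have [//|cpl] := nonedge_or_complete e (C1 :\: C2) (C2 :\: C1).
have ne : C1 != C2 by apply: contraTneq gt1 => ->; rewrite setDv cards0.
have [t1 t2] := min_vertex_cover_trace sg m1 m2.
set L := symdiff C1 C2 in t1 t2.
have cplL i j : i \in trace L C1 -> j \in trace L C2 -> induced e L i j.
  rewrite !inE => i1 j2; apply: cpl; rewrite inE ?i1 ?j2 andbT.
    by have := enum_valP i; rewrite in_symdiff i1.
  by have := enum_valP j; rewrite in_symdiff j2 addbT.
have ct : #|trace L C1| = #|trace L C2|.
  apply/eqP; rewrite -(eqn_add2l #|C1 :&: C2|) -!card_lift_cover.
  by rewrite (lift_cover_trace C1 C2).1 (lift_cover_trace C1 C2).2 (um _ _ m1 m2).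
have umL : unmixed (induced e L).
  (* A cover of a complete bipartite graph contains one of the two sides, and these have equal
     size. *)
  suff cM M : min_vertex_cover (induced e L) M -> #|M| = #|trace L C1|.
    by move=> M1 M2 /cM-> /cM->.
  move=> mM; have [covM mnM] := minsetP mM.
  have [s1|/subsetPn[i i1 iM]] := boolP (trace L C1 \subset M).
    by rewrite (mnM _ (min_vertex_cover_cover t1) s1).
  rewrite ct (mnM _ (min_vertex_cover_cover t2)) //.
  apply/subsetP=> j j2; apply: (vertex_coverP _ _ covM) iM; exact: cplL.
have [sym irr] := induced_simple L sg.
have gtt : (1 < #|trace L C1|)%N.
  rewrite -(ltn_add2l #|C1 :&: C2|) -card_lift_cover (lift_cover_trace C1 C2).1.
  by rewrite -(cardsID C2 C1) ltn_add2l.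
exfalso; apply: (@complete_bipartite_not_CM K _ (induced e L) (trace L C1)) (CM _ _ m1 m2 ne umL) => //.
- by rewrite /stable trace_symdiffC; apply: min_vertex_cover_cover.
- by rewrite /stable setCK; apply: min_vertex_cover_cover.
- by move=> i j i1 j1; apply: cplL => //; rewrite -trace_symdiffC inE.
- by rewrite trace_symdiffC -ct ltnW.
Qed.

(** * Linear syzygies of the cover ideal *)

Lemma cover_genE (K : fieldType) s (e : rel 'I_s) i :
  @cover_gen K s e i = 'X_[mesym1 (enum_val i)].
Proof.
rewrite mpolyXE_id /cover_gen big_mkcond; apply: eq_bigr => t _.
by rewrite mnmE; case: (t \in _).
Qed.

Lemma min_covers_index s (e : rel 'I_s) C :
  min_vertex_cover e C -> exists i : 'I_#|min_covers e|, enum_val i = C.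
Proof.
move=> mC; have CM : C \in min_covers e by rewrite inE.
by exists (enum_rank_in CM C); rewrite enum_rankK_in.
Qed.

Lemma min_vertex_cover_index s (e : rel 'I_s) (i : 'I_#|min_covers e|) :
  min_vertex_cover e (enum_val i).
Proof. by have := enum_valP i; rewrite inE. Qed.

(** Both sides are the exponent of the lcm of the two cover monomials. *)
Lemma mesym1_lcm s (A B : {set 'I_s}) :
  (mesym1 (B :\: A) + mesym1 A = mesym1 (A :\: B) + mesym1 B)%MM.
Proof.
apply/mnmP=> v; rewrite !mnmDE !mnmE !inE.
by case: (v \in A); case: (v \in B).
Qed.

Lemma mcoeffXM (K : fieldType) n (p : {mpoly K[n]}) m k :
  (p * 'X_[m])@_k != 0 -> exists2 l, p@_l != 0 & k = (l + m)%MM.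
Proof.
rewrite -mcoeff_msupp (perm_mem (msuppMX _ _)) => /mapP[l lp ->].
by exists l; rewrite -?mcoeff_msupp // addmC.
Qed.

Lemma sum_neq0_exists (R : nmodType) (I : finType) (P : pred I) (F : I -> R) :
  \sum_(i | P i) F i != 0 -> exists2 i, P i & F i != 0.
Proof.
move=> nz; have [/exists_inP//|] := boolP [exists (i | P i), F i != 0].
rewrite negb_exists_in => /forall_inP F0; case/eqP: nz.
by apply: big1 => i /F0; rewrite negbK => /eqP.
Qed.

(* Reading off one coefficient of a presentation of the pairwise syzygy of [C1]
   and [C2] by linear ones yields a cover one swap away from [C1]. *)
Lemma linearly_presented_swap (K : fieldType) s (e : rel 'I_s) (C1 C2 : {set 'I_s}) :
  cover_ideal_linearly_presented K e ->
  min_vertex_cover e C1 -> min_vertex_cover e C2 -> C1 != C2 ->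
  exists D t, [/\ min_vertex_cover e D, D != C1, t \in C2 :\: C1 & D \subset t |: C1].
Proof.
move=> [_ lp] /min_covers_index[i1 E1] /min_covers_index[i2 E2] ne.
have ne12 : i1 != i2 by apply: contraNneq ne => i12; rewrite -E1 -E2 i12.
pose v i : {mpoly K[s]} := if i == i1 then 'X_[mesym1 (C2 :\: C1)]
  else if i == i2 then - 'X_[mesym1 (C1 :\: C2)] else 0.
have : syzygy (@cover_gen K s e) v.
  rewrite /syzygy (bigD1 i1) //= (bigD1 i2) 1?eq_sym //= big1 ?addr0.
    rewrite /v eqxx eq_sym (negPf ne12) eqxx !cover_genE E1 E2 mulNr -!mpolyXD.
    by rewrite mesym1_lcm subrr.
  by move=> i /andP[n1 n2]; rewrite /v (negPf n1) (negPf n2) mul0r.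
case/lp=> k [a [w [ww /(_ i1)]]]; rewrite /v eqxx.
move/(congr1 (@mcoeff _ _ (mesym1 (C2 :\: C1)))).
rewrite mcoeffX eqxx raddf_sum /= => /eqP; rewrite eq_sym => /eqP aw.
have [|j _] := @sum_neq0_exists K _ predT
    (fun j => (a j * w j i1)@_(mesym1 (C2 :\: C1))).
  by rewrite aw oner_eq0.
rewrite -mcoeff_msupp => /msuppM_le/allpairsP[[m1 m2] /= [_ m2w mE]].
have [syz lin] := ww j.
have /eqP/mdeg1P[t /eqP tE] : mdeg m2 = 1%N by apply: (dhomogP _ _ _ (lin i1)).
subst m2; have tC : t \in C2 :\: C1.
  have := congr1 (fun m : 'X_{1..s} => m t) mE; rewrite mnmDE mnm1E eqxx mnmE addn1.
  by case: (t \in _).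
(* In the linear syzygy [w j], the term ['X_t] times the generator of [C1] must be cancelled by
   another generator, which divides it. *)
move: syz => /(congr1 (@mcoeff _ _ (mesym1 C1 + U_(t))%MM)).
rewrite mcoeff0 raddf_sum /= (bigD1 i1) //= cover_genE E1 mcoeffMX => /eqP.
rewrite addr_eq0 => /eqP wE.
have [|i ni] := @sum_neq0_exists K _ (fun i => i != i1)
    (fun i => (w j i * cover_gen K i)@_(mesym1 C1 + U_(t))).
  by rewrite -oppr_eq0 -wE -mcoeff_msupp.
rewrite cover_genE => /mcoeffXM[l _ lE].
exists (enum_val i), t; split=> //; first exact: min_vertex_cover_index.
  by apply: contraNneq ni => E; apply/eqP/enum_val_inj; rewrite E1.
apply/subsetP=> x xi; have := congr1 (fun m : 'X_{1..s} => m x) lE.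
rewrite !mnmDE !mnmE xi addn1 !inE eq_sym.
by case: (x \in C1); case: (x == t).
Qed.

Lemma linearly_presented_no_complete_diff (K : fieldType) s (e : rel 'I_s) :
  simple_graph e -> unmixed e -> ~ has_3cycle e ->
  cover_ideal_linearly_presented K e -> no_complete_diff e.
Proof.
move=> sg um n3 lp C1 C2 m1 m2 gt1; have [sym irr] := sg.
have [//|cpl12] := nonedge_or_complete e (C1 :\: C2) (C2 :\: C1).
have cpl x y : x \in C1 -> x \notin C2 -> y \in C2 -> y \notin C1 -> e x y.
  by move=> x1 x2 y2 y1; apply: cpl12; rewrite inE ?x1 ?x2 ?y1 ?y2.
have ne : C1 != C2 by apply: contraTneq gt1 => ->; rewrite setDv cards0.
have [D [t [mD DC1 tC sD]]] := linearly_presented_swap lp m1 m2 ne.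
exfalso; move: (tC); rewrite inE => /andP[t1 t2].
have covD := vertex_coverP _ _ (min_vertex_cover_cover mD).
have [c c1 cD] : exists2 c, c \in C1 & c \notin D.
  apply/subsetPn; apply: contra DC1 => sC1; rewrite eq_sym.
  by apply/eqP/(minsetP mD).2; first exact: min_vertex_cover_cover.
have inD x : x \in D -> (x == t) || (x \in C1).
  by move/(subsetP sD); rewrite !inE.
(* If the vertex [c] that leaves is not in [C2], it is adjacent to a vertex of [C2 :\: C1] other
   than [t], and that edge is uncovered. Otherwise [t] and a neighbour [z] of [c] outside [C2]
   complete a triangle. *)
have [c2|c2] := boolP (c \in C2); last first.
  have /card_gt0P[x] : (0 < #|(C2 :\: C1) :\ t|)%N.
    move: gt1; rewrite (card_setD_eq (um _ _ m1 m2)) (cardsD1 t) tC.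
    by rewrite add1n ltnS.
  rewrite !inE => /and3P[xt x1 x2].
  have /inD := covD c x (cpl c x c1 c2 x2 x1) cD.
  by rewrite (negPf xt) (negPf x1).
have [_ /(_ c c1)[w w1 ecw]] := min_vertex_coverP _ sg m1.
have /inD : w \in D by apply: covD ecw cD.
rewrite (negPf w1) orbF => /eqP wt; subst w.
have [_ /(_ c c2)[z z2 ecz]] := min_vertex_coverP _ sg m2.
have /inD : z \in D by apply: covD ecz cD.
case/orP=> [/eqP zt|z1]; first by rewrite zt t2 in z2.
apply: n3; exists c, t, z; split=> //; last 2 first.
- by rewrite sym; apply: cpl.
- by rewrite sym.
rewrite /= !inE negb_or !andbT -andbA.
apply/and3P; split.
- by apply: contraNneq t1 => <-.
- by apply: contraNneq z2 => <-.
- by apply: contraNneq z2 => <-.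
Qed.

(** * From swaps to a linear presentation *)

Definition linearly_generated (K : fieldType) (s r : nat)
  (u v : 'I_r -> {mpoly K[s]}) : Prop :=
  exists k (a : 'I_k -> {mpoly K[s]}) (w : 'I_k -> 'I_r -> {mpoly K[s]}),
    (forall j, syzygy u (w j) /\ forall i, linear_form (w j i)) /\
    forall i, v i = \sum_(j < k) a j * w j i.

Lemma linearly_generated_ext (K : fieldType) s r (u v v' : 'I_r -> {mpoly K[s]}) :
  v =1 v' -> linearly_generated u v -> linearly_generated u v'.
Proof.
by move=> vv' [k [a [w [ww vE]]]]; exists k, a, w; split=> // i; rewrite -vv'.
Qed.

Lemma linearly_generated0 (K : fieldType) s r (u : 'I_r -> {mpoly K[s]}) :
  linearly_generated u (fun=> 0).
Proof.
exists 0%N, (fun=> 0), (fun _ _ => 0); split=> [[]|i] //.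
by rewrite big_ord0.
Qed.

Lemma linearly_generatedD (K : fieldType) s r (u v1 v2 : 'I_r -> {mpoly K[s]}) :
  linearly_generated u v1 -> linearly_generated u v2 ->
  linearly_generated u (fun i => v1 i + v2 i).
Proof.
move=> [k [a [w [ww vE]]]] [l [b [z [zz zE]]]].
exists (k + l)%N, (fun j => match split j with inl i => a i | inr i => b i end),
  (fun j => match split j with inl i => w i | inr i => z i end).
split=> [j|i]; first by case: (split j).
rewrite vE zE big_split_ord /=; congr (_ + _); apply: eq_bigr => j _.
  by rewrite -/(unsplit (inl j)) unsplitK.
by rewrite -/(unsplit (inr j)) unsplitK.
Qed.

Lemma linearly_generatedM (K : fieldType) s r (u v : 'I_r -> {mpoly K[s]}) c :
  linearly_generated u v -> linearly_generated u (fun i => c * v i).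
Proof.
move=> [k [a [w [ww vE]]]]; exists k, (fun j => c * a j), w; split=> // i.
by rewrite vE mulr_sumr; apply: eq_bigr => j _; rewrite mulrA.
Qed.

Lemma linearly_generated_linear (K : fieldType) s r (u v : 'I_r -> {mpoly K[s]}) :
  syzygy u v -> (forall i, linear_form (v i)) -> linearly_generated u v.
Proof.
move=> syz lin; exists 1%N, (fun=> 1), (fun=> v); split=> // i.
by rewrite big_ord1 mul1r.
Qed.

Lemma linearly_generated_sum (K : fieldType) s r (u : 'I_r -> {mpoly K[s]})
    (T : eqType) (q : seq T) (V : T -> 'I_r -> {mpoly K[s]}) :
  {in q, forall t, linearly_generated u (V t)} ->
  linearly_generated u (fun i => \sum_(t <- q) V t i).
Proof.
elim: q => [|t q IH] lg.
  apply: linearly_generated_ext (linearly_generated0 u) => i.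
  by rewrite big_nil.
have lgq : linearly_generated u (fun i => \sum_(t <- q) V t i).
  by apply: IH => x xq; apply: lg; rewrite inE xq orbT.
apply: linearly_generated_ext (linearly_generatedD (lg t (mem_head _ _)) lgq) => i.
by rewrite big_cons.
Qed.

(** The basis vector at [i] scaled to multidegree [mu]; the truncated subtraction is the true
    quotient when the [i]-th generator divides [mu]. *)
Definition mono_vec (K : fieldType) s (e : rel 'I_s) (mu : 'X_{1..s})
  (i : 'I_#|min_covers e|) : 'I_#|min_covers e| -> {mpoly K[s]} :=
  fun l => if l == i then 'X_[mu - mesym1 (enum_val i)] else 0.

(** A cover inside the union of the two also divides [mu], so the difference telescopes through it.
    At distance one the pairwise syzygy is already linear. *)
Lemma mono_vec_diff_generated (K : fieldType) s (e : rel 'I_s) mu i j :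
  simple_graph e -> unmixed e -> no_complete_diff e ->
  (mesym1 (enum_val i) <= mu)%MM -> (mesym1 (enum_val j) <= mu)%MM ->
  linearly_generated (@cover_gen K s e)
    (fun l => @mono_vec K s e mu i l - mono_vec K mu j l).
Proof.
move=> sg um nK.
have [k] := ubnP #|enum_val i :\: enum_val j|; elim: k i j => // k IH i j lt_k li lj.
have mi := min_vertex_cover_index i; have mj := min_vertex_cover_index j.
have cij := card_setD_eq (um _ _ mi mj).
have [gt1|] := ltnP 1 #|enum_val i :\: enum_val j|.
  have [D [mD DU lt1 lt2]] := min_vertex_cover_between sg um nK mi mj gt1.
  have [l lE] := min_covers_index mD; subst D.
  have ll : (mesym1 (enum_val l) <= mu)%MM.
    apply/mnm_lepP=> v; rewrite mnmE; case: (boolP (v \in _)) => // /(subsetP DU).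
    rewrite inE => /orP[vi|vj].
      by have /mnm_lepP/(_ v) := li; rewrite mnmE vi.
    by have /mnm_lepP/(_ v) := lj; rewrite mnmE vj.
  have g1 := IH i l (leq_trans lt1 lt_k) li ll.
  have g2 := IH l j (leq_trans lt2 lt_k) ll lj.
  apply: linearly_generated_ext (linearly_generatedD g1 g2) => t /=.
  by rewrite addrA subrK.
rewrite leq_eqVlt => /orP[/cards1P[p pE]|]; last first.
  rewrite ltnS leqn0 cards_eq0 setD_eq0 => sij.
  have ij : i = j.
    by apply/enum_val_inj/eqP; rewrite eqEcard sij (um _ _ mi mj) leqnn.
  subst j; apply: linearly_generated_ext (linearly_generated0 _) => l.
  by rewrite subrr.
have /eqP/cards1P[q qE] : #|enum_val j :\: enum_val i| = 1%N by rewrite -cij pE cards1.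
have := mesym1_lcm (enum_val i) (enum_val j); rewrite pE qE !mesym1_set1 => lcmE.
pose w l : {mpoly K[s]} := (if l == i then 'X_q else 0) - (if l == j then 'X_p else 0).
have ij : i != j by apply/eqP=> ij; have := set11 p; rewrite -pE ij setDv inE.
have lw : linearly_generated (@cover_gen K s e) w.
  apply: linearly_generated_linear => [|l]; last first.
    rewrite /linear_form; apply: rpredB; case: ifP => _;
      by rewrite ?rpred0 // dhomogX /= mdeg1.
  rewrite /syzygy; under eq_bigr => l _ do rewrite mulrBl.
  rewrite sumrB (bigD1 i) //= eqxx big1 ?addr0; last first.
    by move=> l /negPf->; rewrite mul0r.
  rewrite (bigD1 j) //= eqxx big1 ?addr0; last by move=> l /negPf->; rewrite mul0r.
  by rewrite !cover_genE -!mpolyXD lcmE subrr.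
have lq : (U_(q) + mesym1 (enum_val i) <= mu)%MM.
  have := set11 q; rewrite -qE inE => /andP[qi qj].
  apply/mnm_lepP=> v; rewrite mnmDE mnm1E.
  have [<-|_] := eqVneq q v; last by have /mnm_lepP := li; apply.
  rewrite mnmE (negPf qi) addn0.
  by have /mnm_lepP/(_ q) := lj; rewrite mnmE qj.
set a := (mu - (U_(q) + mesym1 (enum_val i)))%MM.
have aE : mu = (a + (U_(q) + mesym1 (enum_val i)))%MM by rewrite submK.
apply: linearly_generated_ext (linearly_generatedM 'X_[a] lw) => l /=.
rewrite mulrBr /mono_vec; congr (_ - _); case: (l == _); rewrite ?mulr0 // -mpolyXD.
  by rewrite {1}aE addmA addmK.
by rewrite {1}aE lcmE addmA addmK.
Qed.

(** A syzygy is expanded into monomial vectors, and each is compared with one reference vector of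
    its multidegree. *)
Lemma no_complete_diff_linearly_presented (K : fieldType) s (e : rel 'I_s) :
  simple_graph e -> unmixed e -> no_complete_diff e ->
  cover_ideal_linearly_presented K e.
Proof.
move=> sg um nK; split.
  have [i0 _|noi] := pickP (fun i : 'I_#|min_covers e| => true); last first.
    by exists 0%N => i; have := noi i.
  exists #|enum_val i0 : {set 'I_s}| => i; rewrite cover_genE dhomogX /= mdeg_mesym1.
  by apply/eqP/um; apply: min_vertex_cover_index.
pose M i : 'X_{1..s} := mesym1 (enum_val (i : 'I_#|min_covers e|)).
pose b mu := [pick l | (M l <= mu)%MM].
(* [base mu] depends on [mu] only, so its contributions to a syzygy cancel in each
   multidegree. *)
pose base mu l : {mpoly K[s]} := if Some l == b mu then 'X_[(mu - M l)%MM] else 0.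
move=> v syz.
have gen i m : linearly_generated (@cover_gen K s e)
    (fun l => (v i)@_m *: (mono_vec K (m + M i)%MM i l - base (m + M i)%MM l)).
  have lei : (M i <= m + M i)%MM by rewrite addmC lem_addr.
  have lg : linearly_generated (@cover_gen K s e)
      (fun l => mono_vec K (m + M i)%MM i l - base (m + M i)%MM l).
    rewrite /base /b; case: pickP => [l0 le0|/(_ i)]; last by rewrite lei.
    apply: linearly_generated_ext (mono_vec_diff_generated K sg um nK lei le0) => l.
    congr (_ - _); rewrite /mono_vec [Some l == _]/eq_op /=.
    by case: eqP => // ->.
  apply: linearly_generated_ext (linearly_generatedM ((v i)@_m)%:MP lg) => l.
  by rewrite mul_mpolyC.
have sum_gen : linearly_generated (@cover_gen K s e) (fun l =>
    \sum_(i <- enum 'I_#|min_covers e|) \sum_(m <- msupp (v i))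
      (v i)@_m *: (mono_vec K (m + M i)%MM i l - base (m + M i)%MM l)).
  apply: linearly_generated_sum => i _; apply: linearly_generated_sum => m _.
  exact: gen.
apply: linearly_generated_ext sum_gen => l; rewrite big_enum /=.
transitivity (\sum_i \sum_(m <- msupp (v i)) (v i)@_m *: mono_vec K (m + M i)%MM i l
  - \sum_i \sum_(m <- msupp (v i)) (v i)@_m *: base (m + M i)%MM l).
  rewrite -sumrB; apply: eq_bigr => i _; rewrite -sumrB.
  by apply: eq_bigr => m _; rewrite scalerBr.
rewrite (bigD1 l) //= [X in _ + X - _]big1 => [|i il]; last first.
  by apply: big1 => m _; rewrite /mono_vec eq_sym (negPf il) scaler0.
rewrite addr0; under eq_bigr => m _ do rewrite /mono_vec eqxx addmK.
rewrite -mpolyE [X in _ - X](_ : _ = 0) ?subr0 //.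
have bP mu : Some l == b mu -> (M l <= mu)%MM.
  by rewrite /b; case: pickP => // l0 le0 /eqP[->].
apply/mpolyP=> nu; rewrite mcoeff0.
have baseE i m : (base (m + M i)%MM l)@_nu =
    (Some l == b (nu + M l)%MM)%:R * (m + M i == nu + M l)%MM%:R.
  rewrite /base; case: ifPn => [bl|bl].
    rewrite mcoeffX -(eqm_add2r (M l)) submK ?bP //.
    have [<-|_] := eqVneq (m + M i)%MM (nu + M l)%MM; last by rewrite mulr0.
    by rewrite bl mulr1.
  rewrite mcoeff0; have [<-|_] := eqVneq (m + M i)%MM (nu + M l)%MM.
    by rewrite (negPf bl) mul0r.
  by rewrite mulr0.
have := congr1 (@mcoeff _ _ (nu + M l)%MM) syz; rewrite mcoeff0 raddf_sum /= => E.
(* The coefficient at [nu] of the reference part is an indicator times the coefficient of the syzygy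
   relation at [nu + M l], which is zero. *)
rewrite -[RHS](mulr0 (Some l == b (nu + M l)%MM)%:R) -[in RHS]E mulr_sumr raddf_sum.
apply: eq_bigr => i _ /=; rewrite cover_genE -/(M i) {3}(mpolyE (v i)) mulr_suml.
rewrite !raddf_sum /= mulr_sumr; apply: eq_bigr => m _.
by rewrite -scalerAl -mpolyXD !mcoeffZ baseE mcoeffX mulrCA.
Qed.

Theorem theorem5p17 (K : fieldType) (s : nat) (e : rel 'I_s) :
  simple_graph e -> unmixed e -> ~ has_3cycle e -> ~ has_5cycle e ->
  (cover_ideal_linearly_presented K e <->
   (forall C1 C2 : {set 'I_s},
      min_vertex_cover e C1 -> min_vertex_cover e C2 -> C1 != C2 ->
      unmixed (induced e (symdiff C1 C2)) ->
      CM_graph K (induced e (symdiff C1 C2)))).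
Proof.
move=> sg um n3 _; split=> [lp C1 C2 m1 m2 _|CM].
  by apply: induced_symdiff_CM => //; apply: linearly_presented_no_complete_diff lp.
by apply: no_complete_diff_linearly_presented => //; apply: no_complete_diff_CM CM.
Qed.
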